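(* Let $E$ and $F$ be infinite dimensional Banach lattices such that $E$ contains $c_0$, and such that $E^{\ast}$ or $F^{\ast}$ has the bounded positive approximation property. Then the Wittstock tensor product $E\widetilde{\otimes}_{|\varepsilon|}F$ contains a complemented copy of $c_0$, and in particular fails the Grothendieck property. If $F$ is in addition reflexive, then $E\widetilde{\otimes}_{|\varepsilon|}F$ fails the positive Grothendieck property.
   Context: Banach lattices are real. A Banach space contains $c_0$ (contains a copy of $c_0$) if it has a closed subspace linearly homeomorphic to $c_0$; it contains a complemented copy of $c_0$ if such a subspace can be chosen to be the range of a bounded linear projection. Regular norm: for Banach lattices $X,Y$, an operator $T:X\to Y$ is positive if $T(X_+)\subseteq Y_+$; $\mathscr{L}_r(X,Y)$ is the space of differences of positive operators, with norm $\|T\|_r=\inf\{\|S\| : S:X\to Y \text{ positive}, |T(x)|\le S(|x|)\ \forall x\in X\}$. Wittstock tensor product: each $u=\sum_i x_i\otimes y_i\in E\otimes F$ defines the finite rank operator $T_u:E^{\ast}\to F$, $T_u(x^{\ast})=\sum_i \langle x_i,x^{\ast}\rangle y_i$. The Wittstock norm is $\|u\|_{|\varepsilon|}=\|T_u\|_r$, the regular norm in $\mathscr{L}_r(E^{\ast},F)$. $E\widetilde{\otimes}_{|\varepsilon|}F$ is the completion of $E\otimes F$ in this norm, i.e. the closure of $E\otimes F$ in $\mathscr{L}_r(E^{\ast},F)$ for the regular norm, ordered by positivity of operators; it is a Banach lattice. Bounded positive approximation property (BPAP): a Banach lattice $X$ has the BPAP if there is $1\le\lambda<\infty$ such that for every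 compact $C\subseteq X$ and every $\varepsilon>0$ there is a finite rank positive operator $T:X\to X$ with $\|T\|\le\lambda$ and $\|x-T(x)\|\le\varepsilon$ for all $x\in C$. A Banach space $X$ has the Grothendieck property (is a Grothendieck space) if every weak-star null sequence in $X^{\ast}$ is weakly null. A Banach lattice $X$ has the positive Grothendieck property if every weak-star null sequence of positive elements of $X^{\ast}$ is weakly null. *)

(* Defs.v *)
From HB Require Import structures.
From mathcomp Require Import all_boot all_order all_algebra.
From mathcomp Require Import boolp classical_sets functions reals topology.
From mathcomp Require Import normedtype sequences.
From mathcomp Require Import lra.

Set Implicit Arguments.
Unset Strict Implicit.
Unset Printing Implicit Defensive.

Import Order.TTheory GRing.Theory Num.Theory.
Import numFieldNormedType.Exports.

Local Open Scope classical_set_scope.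
Local Open Scope ring_scope.

Reserved Notation "x <=v y" (at level 70, y at next level).

(* The order is a Prop-valued relation rather than a structure of order.v: a   *)
(* porderType on a normed module whose scalars form another type has no join   *)
(* with numDomainType in the existing hierarchy.                               *)
HB.mixin Record isOrderedLmodule (R : realType) V of GRing.Lmodule R V := {
  lev : V -> V -> Prop;
  lev_refl_subproof : forall x, lev x x;
  lev_anti_subproof : forall x y, lev x y -> lev y x -> x = y;
  lev_trans_subproof : forall y x z, lev x y -> lev y z -> lev x z;
  lev_add2r_subproof : forall z x y, lev x y -> lev (x + z) (y + z);
  lev_scale_subproof : forall (a : R) x y, 0 <= a -> lev x y -> lev (a *: x) (a *: y)
}.

#[short(type="orderedNormedModType")]
HB.structure Definition OrderedNormedModule (R : realType) :=
  {V of NormedModule R V & isOrderedLmodule R V}.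

Notation "x <=v y" := (lev x y) : ring_scope.

(* Only joins are required: the meet of x and y is - joinv (- x) (- y).        *)
HB.mixin Record OrderedNormedModule_isLattice (R : realType) V
    of OrderedNormedModule R V := {
  joinv : V -> V -> V;
  leUv_subproof : forall x y z, joinv x y <=v z <-> x <=v z /\ y <=v z;
  lattice_norm_subproof : forall x y : V,
    joinv x (- x) <=v joinv y (- y) -> `|x| <= `|y|
}.

#[short(type="banachLatticeType")]
HB.structure Definition BanachLattice (R : realType) :=
  {V of CompleteNormedModule R V & OrderedNormedModule R V
   & OrderedNormedModule_isLattice R V}.

Definition absv (R : realType) (V : banachLatticeType R) (x : V) : V :=
  joinv x (- x).

Section regular_order.
Variable R : realType.

Let lev0 (x y : R^o) : Prop := x <= y.

Let lev0_anti x y : lev0 x y -> lev0 y x -> x = y.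
Proof. by move=> xy yx; apply/eqP; rewrite eq_le; apply/andP. Qed.

Let lev0_trans y x z : lev0 x y -> lev0 y z -> lev0 x z.
Proof. exact: le_trans. Qed.

Let lev0_add2r z x y : lev0 x y -> lev0 (x + z) (y + z).
Proof. by rewrite /lev0 lerD2r. Qed.

Let lev0_scale (a : R) x y : 0 <= a -> lev0 x y -> lev0 (a *: x) (a *: y).
Proof. by move=> a0 xy; exact: (ler_wpM2l a0 xy). Qed.

HB.instance Definition _ := isOrderedLmodule.Build R R^o
  (@lexx _ _) lev0_anti lev0_trans lev0_add2r lev0_scale.

Let leU0 (x y z : R^o) : (Num.max x y : R^o) <=v z <-> x <=v z /\ y <=v z.
Proof.
rewrite /lev /= /lev0 ge_max; split; first by move/andP.
by move=> [-> ->].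
Qed.

Let norm0 (x y : R^o) :
  (Num.max x (- x) : R^o) <=v (Num.max y (- y) : R^o) -> `|x| <= `|y|.
Proof. by rewrite !maxrN. Qed.

HB.instance Definition _ := OrderedNormedModule_isLattice.Build R R^o leU0 norm0.

End regular_order.


Section ordered.
Variables (R : realType) (V : orderedNormedModType R).
Implicit Types x y z : V.

Lemma lev_refl x : x <=v x. Proof. exact: lev_refl_subproof. Qed.

Lemma lev_anti x y : x <=v y -> y <=v x -> x = y.
Proof. exact: lev_anti_subproof. Qed.

Lemma lev_trans y x z : x <=v y -> y <=v z -> x <=v z.
Proof. exact: lev_trans_subproof. Qed.

Lemma lev_add2r z x y : x <=v y -> x + z <=v y + z.
Proof. exact: lev_add2r_subproof. Qed.

Lemma lev_scale (a : R) x y : 0 <= a -> x <=v y -> a *: x <=v a *: y.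
Proof. exact: lev_scale_subproof. Qed.

Lemma lev_subr x y : x <=v y <-> 0 <=v y - x.
Proof.
split=> [/(lev_add2r (- x))|/(lev_add2r x)]; first by rewrite subrr.
by rewrite add0r subrK.
Qed.

Lemma lev_opp x y : x <=v y -> - y <=v - x.
Proof. by move=> /lev_subr h; apply/lev_subr; rewrite opprK addrC. Qed.

Lemma lev_add x y z t : x <=v y -> z <=v t -> x + z <=v y + t.
Proof.
move=> xy zt; apply: (lev_trans (lev_add2r z xy)).
by rewrite ![y + _]addrC; exact: lev_add2r.
Qed.

Lemma addv_ge0 x y : 0 <=v x -> 0 <=v y -> 0 <=v x + y.
Proof. by move=> /lev_add h /h; rewrite addr0. Qed.

Lemma scalev_ge0 (a : R) x : 0 <= a -> 0 <=v x -> 0 <=v a *: x.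
Proof. by move=> a0 /(lev_scale a0); rewrite scaler0. Qed.

End ordered.

Section lattice.
Variables (R : realType) (V : banachLatticeType R).
Implicit Types x y z : V.

Lemma leUv x y z : joinv x y <=v z <-> x <=v z /\ y <=v z.
Proof. exact: leUv_subproof. Qed.

Lemma lattice_norm x y : absv x <=v absv y -> `|x| <= `|y|.
Proof. exact: lattice_norm_subproof. Qed.

Lemma leUvl x y : x <=v joinv x y.
Proof. by have [/(_ (lev_refl _))[]] := leUv x y (joinv x y). Qed.

Lemma leUvr x y : y <=v joinv x y.
Proof. by have [/(_ (lev_refl _))[]] := leUv x y (joinv x y). Qed.

Lemma joinv_le x y z : x <=v z -> y <=v z -> joinv x y <=v z.
Proof. by move=> xz yz; apply/leUv. Qed.

Lemma joinvC x y : joinv x y = joinv y x.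
Proof.
by apply: lev_anti; apply: joinv_le; [exact: leUvr|exact: leUvl|exact: leUvr|exact: leUvl].
Qed.

Lemma joinvD x y z : joinv x y + z = joinv (x + z) (y + z).
Proof.
apply: lev_anti.
  rewrite -[joinv (x + z) _](subrK z); apply: lev_add2r; apply: joinv_le.
    by rewrite -{1}[x](addrK z); apply: lev_add2r; exact: leUvl.
  by rewrite -{1}[y](addrK z); apply: lev_add2r; exact: leUvr.
by apply: joinv_le; apply: lev_add2r; [exact: leUvl|exact: leUvr].
Qed.

Lemma absv_ge x : x <=v absv x. Proof. exact: leUvl. Qed.

Lemma absv_geN x : - x <=v absv x. Proof. exact: leUvr. Qed.

Lemma absv_le x y : x <=v y -> - x <=v y -> absv x <=v y.
Proof. exact: joinv_le. Qed.

Lemma absv_ge0 x : 0 <=v absv x.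
Proof.
have h : (0 : R) <= 2^-1 by rewrite invr_ge0.
have := lev_add (absv_ge x) (absv_geN x); rewrite subrr => /(lev_scale h).
by rewrite scaler0 scalerDr -scalerDl -[2^-1]div1r -splitr scale1r.
Qed.

Lemma absv_id x : 0 <=v x -> absv x = x.
Proof.
move=> x0; apply: lev_anti; last exact: absv_ge.
apply: absv_le; first exact: lev_refl.
by apply: (lev_trans (y := 0)) => //; rewrite -[X in _ <=v X]oppr0; exact: lev_opp.
Qed.

Lemma absvN x : absv (- x) = absv x.
Proof. by rewrite /absv opprK joinvC. Qed.

Lemma absvD x y : absv (x + y) <=v absv x + absv y.
Proof.
apply: absv_le; first by apply: lev_add; exact: absv_ge.
by rewrite opprD; apply: lev_add; exact: absv_geN.
Qed.

Let absvZ_le (a : R) x : absv (a *: x) <=v `|a| *: absv x.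
Proof.
have [a0|a0] := leP 0 a.
  rewrite ger0_norm//; apply: absv_le; last rewrite -scalerN.
    by apply: lev_scale => //; exact: absv_ge.
  by apply: lev_scale => //; exact: absv_geN.
rewrite ltr0_norm//; have a0' : 0 <= - a by rewrite oppr_ge0 ltW.
apply: absv_le; last rewrite -scaleNr.
  by rewrite -[a *: x]opprK -scalerN -scaleNr; apply: lev_scale => //; exact: absv_geN.
by apply: lev_scale => //; exact: absv_ge.
Qed.

Lemma absvZ (a : R) x : absv (a *: x) = `|a| *: absv x.
Proof.
have [->|a0] := eqVneq a 0.
  by rewrite normr0 !scale0r; apply: absv_id; exact: lev_refl.
apply: lev_anti; first exact: absvZ_le.
have /(lev_scale (normr_ge0 a)) := absvZ_le a^-1 (a *: x).
by rewrite !scalerA mulVf// -normrM mulfV// normr1 !scale1r.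
Qed.

Lemma norm_absv x : `|absv x| = `|x|.
Proof.
have h : absv (absv x) = absv x by apply: absv_id; exact: absv_ge0.
apply/eqP; rewrite eq_le; apply/andP; split; apply: lattice_norm;
  by rewrite h; exact: lev_refl.
Qed.

Lemma normv_le x y : 0 <=v x -> x <=v y -> `|x| <= `|y|.
Proof.
move=> x0 xy; apply: lattice_norm; rewrite !absv_id//.
exact: lev_trans xy.
Qed.

Definition posv x := joinv x 0.

Lemma posv_ge0 x : 0 <=v posv x. Proof. exact: leUvr. Qed.

Lemma posv_ge x : x <=v posv x. Proof. exact: leUvl. Qed.

Lemma posv_id x : 0 <=v x -> posv x = x.
Proof.
move=> x0; apply: lev_anti; last exact: leUvl.
by apply: joinv_le => //; exact: lev_refl.
Qed.

Lemma posvBN x : posv x - posv (- x) = x.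
Proof.
apply/eqP; rewrite subr_eq; apply/eqP.
by rewrite addrC /posv joinvD addNr add0r joinvC.
Qed.

Lemma posv_le x : posv x <=v absv x.
Proof. by apply: joinv_le; [exact: absv_ge|exact: absv_ge0]. Qed.

Lemma riesz x y z : 0 <=v x -> 0 <=v y -> 0 <=v z -> z <=v x + y ->
  exists z1 z2, [/\ z = z1 + z2, 0 <=v z1, z1 <=v x, 0 <=v z2 & z2 <=v y].
Proof.
move=> x0 y0 z0 zxy; exists (z - posv (z - x)), (posv (z - x)); split.
- by rewrite subrK.
- apply: (lev_subr _ _).1; apply: joinv_le => //.
  by apply/lev_subr; rewrite opprB addrC subrK.
- have := lev_add2r (x - posv (z - x)) (posv_ge (z - x)).
  by rewrite addrA subrK [X in _ <=v X]addrC subrK.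
- exact: posv_ge0.
- apply: joinv_le => //; have := lev_add2r (- x) zxy.
  by rewrite [x + y]addrC addrK.
Qed.

End lattice.

Section bounded_operators.
Variables (R : realType) (X Y : normedModType R).

Definition bop_pred : {pred X -> Y} :=
  [pred f | `[< linear f /\ continuous f >]].

Lemma bop_predP (f : X -> Y) : reflect (linear f /\ continuous f) (f \in bop_pred).
Proof. by rewrite unfold_in; exact: asboolP. Qed.

Record bop := Bop { bop_fun :> X -> Y ; bopP : bop_fun \in bop_pred }.

HB.instance Definition _ := [isSub for bop_fun].
HB.instance Definition _ := [Choice of bop by <:].

Let bop_submod_closed : submod_closed bop_pred.
Proof.
split=> [|a f g].
  apply/bop_predP; split.
    by move=> a x y; rewrite -[RHS]/(a *: 0 + 0) scaler0 addr0.
  by move=> x; exact: cvg_cst.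
move=> /bop_predP[lf cf] /bop_predP[lg cg]; apply/bop_predP; split.
  move=> b x y; rewrite -[LHS]/(a *: f _ + g _) lf lg -[RHS]/(b *: (a *: f x + g x) + (a *: f y + g y)).
  by rewrite !scalerDr !scalerA [a * b]mulrC addrACA.
by move=> x; apply: cvgD; [apply: cvgZr; exact: cf|exact: cg].
Qed.

HB.instance Definition _ :=
  GRing.isSubmodClosed.Build R (X -> Y) bop_pred bop_submod_closed.
HB.instance Definition _ := [SubChoice_isSubLmodule of bop by <:].

Let bop_linear (T : bop) : linear T.
Proof. by have /bop_predP[] := bopP T. Qed.

HB.instance Definition _ (T : bop) :=
  GRing.isLinear.Build R X Y *:%R (bop_fun T) (bop_linear T).

Lemma bop_continuous (T : bop) : continuous T.
Proof. by have /bop_predP[] := bopP T. Qed.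

Lemma bopE (T S : bop) : (forall x, T x = S x) -> T = S.
Proof. by move=> TS; apply/val_inj/funext. Qed.

Lemma bopD (T S : bop) x : (T + S) x = T x + S x. Proof. by []. Qed.
Lemma bopN (T : bop) x : (- T) x = - T x. Proof. by []. Qed.
Lemma bopB (T S : bop) x : (T - S) x = T x - S x. Proof. by []. Qed.
Lemma bopZ (a : R) (T : bop) x : (a *: T) x = a *: T x. Proof. by []. Qed.
Lemma bop0 x : (0 : bop) x = 0. Proof. by []. Qed.

Lemma bop_bound (f : X -> Y) (M : R) : linear f ->
  (forall x, `|f x| <= M * `|x|) -> f \in bop_pred.
Proof.
move=> lf fM; apply/bop_predP; split=> //.
pose L := GRing.isLinear.Build R X Y *:%R f lf.
pose F : {linear X -> Y} := HB.pack f L.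
have := @bounded_linear_continuous R X Y F; apply.
apply/linear_boundedP; near=> r => x; apply: (le_trans (fM x)).
by apply: ler_wpM2r => //; near: r; apply: nbhs_pinfty_ge; rewrite num_real.
Unshelve. all: by end_near. Qed.

Definition opnorm (T : bop) : R := sup [set `|T x| | x in [set x | `|x| <= 1]].

Let opnorm_set0 (T : bop) : [set `|T x| | x in [set x | `|x| <= 1]] 0.
Proof. by exists 0; rewrite /= ?normr0 ?linear0 ?normr0. Qed.

Let opnorm_has_sup (T : bop) : has_sup [set `|T x| | x in [set x | `|x| <= 1]].
Proof.
split; first by exists 0; exact: opnorm_set0.
have : bounded_near T (nbhs 0).
  by apply/linear_bounded_continuous; exact: bop_continuous.
move=> /linear_boundedP/pinfty_ex_gt0[M M0 TM].
exists M => _ [x /= x1 <-]; apply: (le_trans (TM x)).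
by rewrite -[leRHS]mulr1 ler_wpM2l// ltW.
Qed.

Let opnorm_ge0 (T : bop) : 0 <= opnorm T.
Proof. by apply: sup_upper_bound => //; exact: opnorm_set0. Qed.

Let opnorm_bound (T : bop) x : `|T x| <= opnorm T * `|x|.
Proof.
have [->|x0] := eqVneq x 0; first by rewrite linear0 !normr0 mulr0.
have nx : 0 < `|x| by rewrite normr_gt0.
rewrite -ler_pdivrMr//; apply: sup_upper_bound => //.
exists (`|x|^-1 *: x) => /=.
  by rewrite normrZ normfV normr_id mulVf// gt_eqF.
by rewrite linearZ normrZ normfV normr_id mulrC.
Qed.

Let opnorm_le (T : bop) (M : R) : 0 <= M ->
  (forall x, `|T x| <= M * `|x|) -> opnorm T <= M.
Proof.
move=> M0 TM; apply: ge_sup; first by exists 0; exact: opnorm_set0.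
move=> _ [x /= x1 <-]; apply: (le_trans (TM x)).
by rewrite -[leRHS]mulr1 ler_wpM2l.
Qed.

Let opnormD (T S : bop) : opnorm (T + S) <= opnorm T + opnorm S.
Proof.
apply: opnorm_le => [|x]; first by rewrite addr_ge0 ?opnorm_ge0.
by rewrite bopD mulrDl (le_trans (ler_normD _ _))// lerD// opnorm_bound.
Qed.

Let opnormZ_le (a : R) (T : bop) : opnorm (a *: T) <= `|a| * opnorm T.
Proof.
apply: opnorm_le => [|x]; first by rewrite mulr_ge0 ?opnorm_ge0.
by rewrite bopZ normrZ -mulrA ler_wpM2l// opnorm_bound.
Qed.

Let opnormZ (a : R) (T : bop) : opnorm (a *: T) = `|a| * opnorm T.
Proof.
apply/eqP; rewrite eq_le opnormZ_le /=.
have [->|a0] := eqVneq a 0; first by rewrite normr0 mul0r opnorm_ge0.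
rewrite -ler_pdivlMl ?normr_gt0//.
have := opnormZ_le a^-1 (a *: T).
by rewrite scalerA mulVf// scale1r normfV.
Qed.

Let opnorm_eq0 (T : bop) : opnorm T = 0 -> T = 0.
Proof.
move=> T0; apply: bopE => x; apply/eqP; rewrite -normr_le0.
by have := opnorm_bound T x; rewrite T0 mul0r.
Qed.

HB.instance Definition _ :=
  Lmodule_isNormed.Build R bop opnormD opnormZ opnorm_eq0.

Lemma opnormP (T : bop) x : `|T x| <= `|T| * `|x|.
Proof. exact: opnorm_bound. Qed.

Lemma bop_norm_le (T : bop) (M : R) : 0 <= M ->
  (forall x, `|T x| <= M * `|x|) -> `|T| <= M.
Proof. exact: opnorm_le. Qed.

End bounded_operators.
Arguments bop {R} X Y.

Notation dual X := (bop X (_^o)).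

Section bop_complete.
Variables (R : realType) (X : normedModType R) (Y : completeNormedModType R).

Let bop_cauchy_cvg (F : set_system (bop X Y)) :
  ProperFilter F -> cauchy F -> cvg F.
Proof.
move=> FF /cauchy_ballP Fc.
have evc x : cvg ((fun T : bop X Y => T x) @ F).
  apply: cauchy_cvg; apply/cauchy_ballP => e e0.
  have x1 : 0 < `|x| + 1 by rewrite ltr_wpDl.
  have d0 : 0 < e / (`|x| + 1) by rewrite divr_gt0.
  have [[A B] /= [FA FB] AB] := Fc _ d0.
  exists ((fun T : bop X Y => T x) @` A, (fun T : bop X Y => T x) @` B) => /=.
    by split; [apply: filterS FA|apply: filterS FB] => T ?; exists T.
  move=> [u v] /= [[T AT <-] [S BS <-]].
  have := AB (T, S) (conj AT BS); rewrite -!ball_normE /= => TS.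
  rewrite -bopB (le_lt_trans (opnormP _ _))//.
  apply: (@le_lt_trans _ _ (e / (`|x| + 1) * `|x|)).
    by rewrite ler_wpM2r// ltW.
  by rewrite mulrAC ltr_pdivrMr// ltr_pM2l// ltrDl.
pose f x : Y := lim ((fun T : bop X Y => T x) @ F).
have fP x (e : R) : 0 < e -> F [set T : bop X Y | `|f x - T x| < e].
  by move=> e0; have /cvgrPdist_lt := evc x; exact.
have fle x (c : Y) (M : R) : F [set T : bop X Y | `|c - T x| <= M] ->
    `|c - f x| <= M.
  move=> cM; apply/ler_addgt0Pr => e e0.
  have [T [cT fT]] := filter_ex (filterI cM (fP x _ e0)).
  rewrite (le_trans (ler_distD (T x) _ _))// lerD//.
  by rewrite distrC ltW.
have lf : linear f.
  move=> a x y; apply: cvg_lim => //.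
  under eq_fun do rewrite linearP.
  by apply: cvgD; [apply: cvgZr; exact: evc|exact: evc].
have bd (M : R) : 0 < M -> exists2 T0 : bop X Y, F [set T | `|T0 - T| < M] &
    forall x, `|T0 x - f x| <= M * `|x|.
  move=> M0; have [[A B] /= [FA FB] AB] := Fc _ M0.
  have [T0 AT0] := filter_ex FA.
  have FT0 : F [set T | `|T0 - T| < M].
    by apply: filterS FB => T BT; have := AB (T0, T) (conj AT0 BT); rewrite -ball_normE.
  exists T0 => // x; apply: fle; apply: filterS FT0 => T /= /ltW TM.
  by rewrite -bopB (le_trans (opnormP _ _))// ler_wpM2r.
have fb : f \in @bop_pred R X Y.
  have [T0 _ T0f] := bd 1 ltr01.
  apply: (@bop_bound _ _ _ _ (`|T0| + 1)) => // x.
  rewrite mulrDl -[f x](subrK (T0 x)) [leRHS]addrC (le_trans (ler_normD _ _))//.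
  by rewrite distrC lerD ?opnormP.
apply/cvg_ex; exists (Bop fb); apply/cvgrPdist_le => e e0.
have e20 : 0 < e / 2 by rewrite divr_gt0.
have [T0 FT0 T0f] := bd _ e20.
have T0f' : `|T0 - Bop fb| <= e / 2.
  by apply: bop_norm_le; [exact: ltW|exact: T0f].
apply: filterS FT0 => T /= /ltW T0T.
rewrite (le_trans (ler_distD T0 _ _))// [leRHS]splitr lerD//.
by rewrite distrC.
Qed.

HB.instance Definition _ := Uniform_isComplete.Build (bop X Y) bop_cauchy_cvg.

End bop_complete.


Definition positive (R : realType) (X Y : orderedNormedModType R)
  (T : bop X Y) : Prop := forall x, 0 <=v x -> 0 <=v T x.

Section bop_order.
Variables (R : realType) (X : banachLatticeType R) (Y : orderedNormedModType R).
Implicit Types T S : bop X Y.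

Definition bop_le T S : Prop := positive (S - T).

Let bop_leE T S : bop_le T S <-> forall x, 0 <=v x -> T x <=v S x.
Proof.
split=> h x x0; first exact: (lev_subr _ _).2 (h x x0).
exact: (lev_subr _ _).1 (h x x0).
Qed.

Let bop_le_refl T : bop_le T T.
Proof. by apply/bop_leE => x _; exact: lev_refl. Qed.

Let bop_le_anti T S : bop_le T S -> bop_le S T -> T = S.
Proof.
move=> /bop_leE TS /bop_leE ST; apply: bopE => x.
rewrite -[x]posvBN !linearB /=; congr (_ - _);
  by apply: lev_anti; [apply: TS|apply: ST]; exact: posv_ge0.
Qed.

Let bop_le_trans S T U : bop_le T S -> bop_le S U -> bop_le T U.
Proof.
move=> /bop_leE TS /bop_leE SU; apply/bop_leE => x x0.
exact: lev_trans (TS x x0) (SU x x0).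
Qed.

Let bop_le_add2r U T S : bop_le T S -> bop_le (T + U) (S + U).
Proof.
by move=> /bop_leE TS; apply/bop_leE => x x0; rewrite !bopD; exact/lev_add2r/TS.
Qed.

Let bop_le_scale (a : R) T S : 0 <= a -> bop_le T S -> bop_le (a *: T) (a *: S).
Proof.
move=> a0 /bop_leE TS; apply/bop_leE => x x0; rewrite !bopZ.
exact/lev_scale/TS.
Qed.

HB.instance Definition _ := isOrderedLmodule.Build R (bop X Y)
  bop_le_refl bop_le_anti bop_le_trans bop_le_add2r bop_le_scale.

Lemma bop_leP T S : T <=v S <-> forall x, 0 <=v x -> T x <=v S x.
Proof. exact: bop_leE. Qed.

Lemma bop_ge0P T : 0 <=v T <-> positive T.
Proof. by split=> [/bop_leP h x /h|h]; [|apply/bop_leP => x /h]. Qed.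

End bop_order.

(* The dual of a Banach lattice is a Banach lattice for the order inherited    *)
(* from bop; the positive part fpos f of a functional is given on the positive *)
(* cone by the Riesz-Kantorovich formula (fpos f) x = sup (f [0, x]).          *)
Section dual_lattice.
Variables (R : realType) (E : banachLatticeType R).
Implicit Types f g h : dual E.

#[local] Hint Resolve posv_ge0 : core.

Section cone_extension.
Variable q : E -> R^o.
Hypothesis qD : forall x y, 0 <=v x -> 0 <=v y -> q (x + y) = q x + q y.
Hypothesis qZ : forall (a : R) x, 0 <= a -> 0 <=v x -> q (a *: x) = a * q x.

Definition cone_ext x : R^o := q (posv x) - q (posv (- x)).

Lemma cone_extE x u v : 0 <=v u -> 0 <=v v -> x = u - v ->
  cone_ext x = q u - q v.
Proof.
move=> u0 v0 xuv; have /(congr1 q) : posv x + v = u + posv (- x).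
  by rewrite -[posv x](subrK (posv (- x))) posvBN {1}xuv addrAC subrK.
rewrite !qD // /cone_ext => h; apply/eqP.
by rewrite subr_eq addrAC eq_sym subr_eq eq_sym h.
Qed.

Lemma cone_ext_id x : 0 <=v x -> cone_ext x = q x.
Proof.
move=> x0; have q0 : q 0 = 0 by rewrite -(scale0r x) qZ// mul0r.
by rewrite (@cone_extE x x 0) ?subr0 ?q0 ?subr0//; exact: lev_refl.
Qed.

Lemma cone_ext_linear : linear cone_ext.
Proof.
move=> a x y; have [a0|a0] := leP 0 a.
  rewrite (@cone_extE _ (a *: posv x + posv y) (a *: posv (- x) + posv (- y))).
  - rewrite !qD ?qZ//; do ?[exact: scalev_ge0].
    by rewrite /cone_ext -[a *: _]/(a * _) mulrBr opprD addrACA.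
  - by apply: addv_ge0; [apply: scalev_ge0 => //|]; exact: posv_ge0.
  - by apply: addv_ge0; [apply: scalev_ge0 => //|]; exact: posv_ge0.
  - by rewrite opprD addrACA posvBN -scalerBr posvBN.
have a0' : 0 <= - a by rewrite oppr_ge0 ltW.
rewrite (@cone_extE _ (- a *: posv (- x) + posv y) (- a *: posv x + posv (- y))).
- rewrite !qD ?qZ//; do ?[exact: scalev_ge0].
  rewrite /cone_ext -[a *: _]/(a * _) mulrBr opprD addrACA !mulNr opprK.
  by rewrite [- _ + _]addrC.
- by apply: addv_ge0; [apply: scalev_ge0 => //|]; exact: posv_ge0.
- by apply: addv_ge0; [apply: scalev_ge0 => //|]; exact: posv_ge0.
- by rewrite opprD addrACA posvBN !scaleNr opprK addrC -[- _ + _]addrC -scalerBr posvBN addrC.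
Qed.

End cone_extension.

Definition sup_below f x : R^o := sup [set f y | y in [set y | 0 <=v y /\ y <=v x]].

Let sup_below_has f x : 0 <=v x ->
  has_sup [set f y | y in [set y | 0 <=v y /\ y <=v x]].
Proof.
move=> x0; split; first by exists (f 0); exists 0 => //; split => //; exact: lev_refl.
exists (`|f| * `|x|) => _ [y [y0 yx] <-].
apply: (le_trans (ler_norm _)); apply: (le_trans (opnormP f y)).
by rewrite ler_wpM2l// normv_le.
Qed.

Let sup_below_ge f x y : 0 <=v y -> y <=v x -> f y <= sup_below f x.
Proof.
move=> y0 yx; apply: sup_upper_bound; last by exists y.
by apply: sup_below_has; exact: lev_trans yx.
Qed.

Let sup_below_le f x (M : R) : 0 <=v x ->
  (forall y, 0 <=v y -> y <=v x -> f y <= M) -> sup_below f x <= M.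
Proof.
move=> x0 fM; apply: ge_sup; first by have [] := sup_below_has f x0.
by move=> _ [y [y0 yx] <-]; exact: fM.
Qed.

Let sup_belowD f x y : 0 <=v x -> 0 <=v y ->
  sup_below f (x + y) = sup_below f x + sup_below f y.
Proof.
move=> x0 y0; have xy0 := addv_ge0 x0 y0; apply/eqP; rewrite eq_le; apply/andP; split.
  apply: sup_below_le => // z z0 zxy.
  have [z1 [z2 [-> z10 z1x z20 z2y]]] := riesz x0 y0 z0 zxy.
  by rewrite linearD lerD// sup_below_ge.
rewrite -lerBrDr; apply: sup_below_le => // u u0 ux.
rewrite lerBrDr addrC -lerBrDr; apply: sup_below_le => // v v0 vy.
rewrite lerBrDr -linearD addrC; apply: sup_below_ge.
  exact: addv_ge0.
exact: lev_add.
Qed.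

Let sup_belowZ f (a : R) x : 0 <= a -> 0 <=v x ->
  sup_below f (a *: x) = a * sup_below f x.
Proof.
rewrite le_eqVlt => /predU1P[<-|a0] x0.
  rewrite scale0r mul0r; apply/eqP; rewrite eq_le; apply/andP; split.
    apply: sup_below_le => [|y y0 yz]; first exact: lev_refl.
    by rewrite (lev_anti yz y0) linear0.
  by rewrite -(linear0 f); apply: sup_below_ge; exact: lev_refl.
have a0' := ltW a0; have ai0 : 0 <= a^-1 by rewrite invr_ge0.
apply/eqP; rewrite eq_le; apply/andP; split.
  apply: sup_below_le => [|y y0 yx]; first exact: scalev_ge0.
  rewrite -ler_pdivrMl// -[_ * f y]/(a^-1 *: f y) -linearZ; apply: sup_below_ge.
    exact: scalev_ge0.
  by have := lev_scale ai0 yx; rewrite scalerA mulVf ?scale1r// gt_eqF.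
rewrite -ler_pdivlMl//; apply: sup_below_le => // y y0 yx.
rewrite ler_pdivlMl// -[a * f y]/(a *: f y) -linearZ; apply: sup_below_ge.
  exact: scalev_ge0.
exact: lev_scale.
Qed.

Let fpos_subproof f : cone_ext (sup_below f) \in @bop_pred R E R^o.
Proof.
apply: (@bop_bound _ _ _ _ (`|f| + `|f|)).
  by apply: cone_ext_linear; [exact: sup_belowD|exact: sup_belowZ].
have H u x : `|u| <= `|x| -> 0 <=v u -> `|sup_below f u| <= `|f| * `|x|.
  move=> ux u0; rewrite ger0_norm; last first.
    by rewrite -(linear0 f); apply: sup_below_ge => //; exact: lev_refl.
  apply: sup_below_le => // y y0 yu.
  rewrite (le_trans (ler_norm _))// (le_trans (opnormP f y))// ler_wpM2l//.
  by rewrite (le_trans _ ux)// normv_le.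
have pn (x : E) : `|posv x| <= `|x|.
  by rewrite -(norm_absv x); apply: normv_le; [exact: posv_ge0|exact: posv_le].
move=> x; rewrite /cone_ext (le_trans (ler_normB _ _))// mulrDl lerD//.
  by apply: H => //; exact: posv_ge0.
by apply: H; [rewrite -(normrN x)|exact: posv_ge0].
Qed.

Definition fpos f : dual E := Bop (fpos_subproof f).

Lemma fposE f x : 0 <=v x -> fpos f x = sup_below f x.
Proof. by apply: cone_ext_id; [exact: sup_belowD|exact: sup_belowZ]. Qed.

Definition dual_join f g : dual E := fpos (f - g) + g.

Let dual_leUv f g h : dual_join f g <=v h <-> f <=v h /\ g <=v h.
Proof.
split=> [/bop_leP H|[/bop_leP fh /bop_leP gh]].
  split; apply/bop_leP => x x0; apply: lev_trans (H x x0);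
    rewrite /dual_join bopD fposE// /lev /=.
    rewrite -lerBlDr -[f x - g x]/((f - g) x).
    by apply: sup_below_ge => //; exact: lev_refl.
  rewrite lerDr -(linear0 (f - g)).
  by apply: sup_below_ge => //; exact: lev_refl.
apply/bop_leP => x x0; rewrite /dual_join bopD fposE// /lev /= -lerBrDr.
apply: sup_below_le => // y y0 /lev_subr yx.
rewrite bopB lerBrDr -addrA [- g y + _]addrC -linearB /= -[leRHS](subrK (h y)).
rewrite -linearB /= addrC lerD//.
  exact: gh.
exact: fh.
Qed.

Let dual_norm f g :
  dual_join f (- f) <=v dual_join g (- g) -> `|f| <= `|g|.
Proof.
move=> fg; apply: bop_norm_le => // x.
have [/bop_leP f1 /bop_leP f2] := (dual_leUv f (- f) _).1 fg.
set G := dual_join g (- g) in f1 f2.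
have a0 := absv_ge0 x.
have Gle u : 0 <=v u -> G u <= `|g| * `|u|.
  move=> u0; rewrite /G /dual_join bopD fposE// bopN lerBlDr.
  apply: sup_below_le => // y y0 yu; rewrite opprK bopD -lerBlDr -addrA.
  rewrite -linearB -linearD /= (le_trans (ler_norm _))//.
  rewrite (le_trans (opnormP g _))// ler_wpM2l// lattice_norm//.
  rewrite [absv u]absv_id//; apply: absv_le.
    have yu0 : y - u <=v 0.
      by have := lev_add2r (- u) yu; rewrite subrr.
    by have := lev_add yu yu0; rewrite addr0.
  have y0' : - y <=v 0 by have := lev_opp y0; rewrite oppr0.
  have uy : u - y <=v u by have := lev_add (lev_refl u) y0'; rewrite addr0.
  by rewrite opprD opprB; have := lev_add y0' uy; rewrite add0r.
rewrite -(norm_absv x); apply: le_trans (Gle _ a0); clearbody G.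
have hp : 0 <=v absv x + x.
  by have := (lev_subr _ _).1 (absv_geN x); rewrite opprK.
have hm : 0 <=v absv x - x by apply: (lev_subr _ _).1; exact: absv_ge.
have := f1 _ hp; have := f1 _ hm; have := f2 _ hp; have := f2 _ hm.
rewrite !bopN !linearB !linearD /lev /=.
move: (f x : R) (f (absv x) : R) (G x : R) (G (absv x) : R) => /= a b c d h1 h2 h3 h4.
by rewrite ler_norml; apply/andP; split; lra.
Qed.

HB.instance Definition _ := OrderedNormedModule_isLattice.Build R (dual E)
  dual_leUv dual_norm.

End dual_lattice.

Section regular_operators.
Variables (R : realType) (X Y : banachLatticeType R).

Definition regular_pred : {pred bop X Y} := [pred T |
  `[< exists S1 S2 : bop X Y, [/\ positive S1, positive S2 & T = S1 - S2] >]].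

Lemma regular_predP (T : bop X Y) : reflect
  (exists S1 S2 : bop X Y, [/\ positive S1, positive S2 & T = S1 - S2])
  (T \in regular_pred).
Proof. by rewrite unfold_in; exact: asboolP. Qed.

(* The differences of positive operators, with the regular norm regnorm below. *)
(* Positive operators between Banach lattices are automatically bounded, so    *)
(* nothing is lost by taking them in bop.                                      *)
Record regop := RegOp { regop_val :> bop X Y ; regopP : regop_val \in regular_pred }.

HB.instance Definition _ := [isSub for regop_val].
HB.instance Definition _ := [Choice of regop by <:].

Let positiveD (S T : bop X Y) : positive S -> positive T -> positive (S + T).
Proof. by move=> pS pT x x0; rewrite bopD; apply: addv_ge0; [exact: pS|exact: pT]. Qed.

Let positiveZ (a : R) (S : bop X Y) : 0 <= a -> positive S -> positive (a *: S).
Proof. by move=> a0 pS x x0; rewrite bopZ; apply: scalev_ge0 => //; exact: pS. Qed.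

Let regular_submod_closed : submod_closed regular_pred.
Proof.
split=> [|a f g].
  apply/regular_predP; exists 0, 0; rewrite subr0.
  by split=> // x _; rewrite bop0; exact: lev_refl.
move=> /regular_predP[f1 [f2 [pf1 pf2 ->]]] /regular_predP[g1 [g2 [pg1 pg2 ->]]].
apply/regular_predP; have [a0|a0] := leP 0 a.
  exists (a *: f1 + g1), (a *: f2 + g2); split.
  - by apply: positiveD => //; exact: positiveZ.
  - by apply: positiveD => //; exact: positiveZ.
  - by rewrite [in RHS]opprD [RHS]addrACA scalerBr.
have a0' : 0 <= - a by rewrite oppr_ge0 ltW.
exists ((- a) *: f2 + g1), ((- a) *: f1 + g2); split.
- by apply: positiveD => //; exact: positiveZ.
- by apply: positiveD => //; exact: positiveZ.
- by rewrite [in RHS]opprD [RHS]addrACA !scaleNr opprK scalerBr [a *: f1 - _]addrC.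
Qed.

HB.instance Definition _ := GRing.isSubmodClosed.Build R (bop X Y) regular_pred
  regular_submod_closed.
HB.instance Definition _ := [SubChoice_isSubLmodule of regop by <:].

Definition dominated_by (T S : bop X Y) : Prop :=
  positive S /\ forall x, absv (T x) <=v S (absv x).

Definition regnorm (T : regop) : R :=
  inf [set `|S| | S in [set S : bop X Y | dominated_by T S]].

Let regnorm_has_inf (T : regop) :
  has_inf [set `|S| | S in [set S : bop X Y | dominated_by T S]].
Proof.
split; last by exists 0 => _ [S _ <-].
have /regular_predP[S1 [S2 [p1 p2 e]]] := regopP T.
exists `|S1 + S2|; exists (S1 + S2) => //=; split; first exact: positiveD.
have H (S : bop X Y) x : positive S -> absv (S x) <=v S (absv x).
  move=> pS; apply: absv_le; apply: (lev_subr _ _).2.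
    by rewrite -linearB; apply: pS; apply: (lev_subr _ _).1; exact: absv_ge.
  rewrite opprK -linearD; apply: pS.
  by have := (lev_subr _ _).1 (absv_geN x); rewrite opprK.
move=> x; rewrite e bopB bopD; apply: lev_trans (absvD _ _) _.
by rewrite absvN; apply: lev_add; exact: H.
Qed.

Let regnorm_le (T : regop) (S : bop X Y) : dominated_by T S -> regnorm T <= `|S|.
Proof. by move=> TS; apply: ge_inf; [have [] := regnorm_has_inf T|exists S]. Qed.

Let regnorm_ge (T : regop) (M : R) :
  (forall S : bop X Y, dominated_by T S -> M <= `|S|) -> M <= regnorm T.
Proof.
move=> MS; apply: lb_le_inf; first by have [] := regnorm_has_inf T.
by move=> _ [S TS <-]; exact: MS.
Qed.

Let regnormD (T S : regop) : regnorm (T + S) <= regnorm T + regnorm S.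
Proof.
rewrite -lerBlDr; apply: regnorm_ge => T' [pT' TT'].
rewrite lerBlDr [leRHS]addrC -lerBlDr; apply: regnorm_ge => S' [pS' SS'].
rewrite lerBlDr; apply: (le_trans _ (ler_normD _ _)); apply: regnorm_le.
split=> [|x]; first exact: positiveD.
rewrite [T + S]addrC !bopD; apply: lev_trans (absvD _ _) _.
by apply: lev_add.
Qed.

Let regnormZ_le (a : R) (T : regop) : regnorm (a *: T) <= `|a| * regnorm T.
Proof.
have [->|a0] := eqVneq a 0.
  rewrite normr0 mul0r scale0r -(normr0 (bop X Y)); apply: regnorm_le.
  split=> [x _|x]; rewrite bop0; first exact: lev_refl.
  by rewrite absv_id; exact: lev_refl.
rewrite -ler_pdivrMl ?normr_gt0//; apply: regnorm_ge => S [pS TS].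
rewrite ler_pdivrMl ?normr_gt0// -[`|a|]normr_id -normrZ; apply: regnorm_le.
split=> [|x]; first exact: positiveZ.
by rewrite !bopZ absvZ; apply: lev_scale.
Qed.

Let regnormZ (a : R) (T : regop) : regnorm (a *: T) = `|a| * regnorm T.
Proof.
apply/eqP; rewrite eq_le regnormZ_le /=.
have [->|a0] := eqVneq a 0.
  by rewrite normr0 mul0r; apply: regnorm_ge.
rewrite -ler_pdivlMl ?normr_gt0//.
have := regnormZ_le a^-1 (a *: T).
by rewrite scalerA mulVf// scale1r normfV.
Qed.

Let opnorm_le_regnorm (T : regop) : `|regop_val T| <= regnorm T.
Proof.
apply: regnorm_ge => S [pS TS]; apply: bop_norm_le => // x.
rewrite -(norm_absv (T x)) -(norm_absv x).
apply: le_trans (opnormP S _); apply: normv_le; first exact: absv_ge0.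
exact: TS.
Qed.

Let regnorm_eq0 (T : regop) : regnorm T = 0 -> T = 0.
Proof.
move=> T0; apply/val_inj/eqP; rewrite -normr_le0 -T0.
exact: opnorm_le_regnorm.
Qed.

HB.instance Definition _ :=
  Lmodule_isNormed.Build R regop regnormD regnormZ regnorm_eq0.

Let regop_le (T S : regop) : Prop := regop_val T <=v regop_val S.

Let regop_le_refl T : regop_le T T. Proof. exact: lev_refl. Qed.

Let regop_le_anti T S : regop_le T S -> regop_le S T -> T = S.
Proof. by move=> TS ST; apply/val_inj/lev_anti. Qed.

Let regop_le_trans S T U : regop_le T S -> regop_le S U -> regop_le T U.
Proof. exact: lev_trans. Qed.

Let regop_le_add2r U T S : regop_le T S -> regop_le (T + U) (S + U).
Proof. exact: lev_add2r. Qed.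

Let regop_le_scale (a : R) T S : 0 <= a -> regop_le T S ->
  regop_le (a *: T) (a *: S).
Proof. exact: lev_scale. Qed.

HB.instance Definition _ := isOrderedLmodule.Build R regop
  regop_le_refl regop_le_anti regop_le_trans regop_le_add2r regop_le_scale.

End regular_operators.
Arguments regop {R} X Y.


Section wittstock.
Variables (R : realType) (E F : banachLatticeType R).

Section rank_one.
Variables (x : E) (y : F).

Definition rank_one_fun (f : bop E R^o) : F := f x *: y.

Let rank_one_bop : rank_one_fun \in @bop_pred R (dual E) F.
Proof.
apply: (@bop_bound _ _ _ _ (`|x| * `|y|)) => [a f g|f]; rewrite /rank_one_fun.
  by rewrite bopD bopZ scalerDl scalerA.
by rewrite normrZ mulrAC ler_wpM2r// mulrC opnormP.
Qed.

Definition rank_one : bop (dual E) F := Bop rank_one_bop.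

End rank_one.

Let rank_one_pos x y : 0 <=v x -> 0 <=v y -> positive (rank_one x y).
Proof.
move=> x0 y0 f /bop_ge0P f0; rewrite /= /rank_one_fun.
by apply: scalev_ge0 => //; exact: (f0 x x0).
Qed.

Let rank_one_regular x y :
  rank_one x y \in @regular_pred R (dual E) F.
Proof.
have -> : rank_one x y =
    (rank_one (posv x) (posv y) - rank_one (posv x) (posv (- y))) -
    (rank_one (posv (- x)) (posv y) - rank_one (posv (- x)) (posv (- y))).
  apply: bopE => f; rewrite !bopB /= /rank_one_fun -!scalerBr posvBN -scalerBl.
  by rewrite -linearB posvBN.
have reg u v : 0 <=v u -> 0 <=v v -> rank_one u v \in @regular_pred R (dual E) F.
  move=> u0 v0; apply/regular_predP; exists (rank_one u v), 0; rewrite subr0.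
  split=> //; first exact: rank_one_pos.
  by move=> f _; rewrite bop0; exact: lev_refl.
by rewrite !rpredB// reg//; exact: posv_ge0.
Qed.

Definition tensor1 x y : regop (dual E) F := RegOp (rank_one_regular x y).

(* An element of the algebraic tensor product is represented by a finite       *)
(* formal sum; tensor u is the operator T_u, see tensorE. The map u |-> T_u is *)
(* injective on the tensor product, because the dual of E separates points.    *)
Definition tensor (u : seq (E * F)) : regop (dual E) F :=
  \sum_(p <- u) tensor1 p.1 p.2.

Lemma tensorE u f : tensor u f = \sum_(p <- u) f p.1 *: p.2.
Proof.
rewrite /tensor; elim: u => [|p u IH]; first by rewrite !big_nil.
by rewrite !big_cons -IH.
Qed.

Definition wittstock_pred : {pred regop (dual E) F} :=
  [pred T | `[< closure (range tensor) T >]].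

Lemma wittstock_predP T : reflect (closure (range tensor) T) (T \in wittstock_pred).
Proof. by rewrite unfold_in; exact: asboolP. Qed.

(* The closure is taken in regop (dual E) F, i.e. for the regular norm, which  *)
(* is complete; wittstock inherits its norm and order.                         *)
Record wittstock := Wittstock
  { wittstock_val :> regop (dual E) F ; wittstockP : wittstock_val \in wittstock_pred }.

HB.instance Definition _ := [isSub for wittstock_val].
HB.instance Definition _ := [Choice of wittstock by <:].

Let closure_normP (V : normedModType R) (A : set V) v :
  closure A v <-> forall e : R, 0 < e -> exists2 w, A w & `|v - w| < e.
Proof.
split=> [clA e e0|H B /nbhs_ballP[e /= e0 eB]].
  have /clA[w [Aw]] := nbhsx_ballx v e e0.
  by rewrite -ball_normE /= => vw; exists w.
have [w Aw vw] := H e e0; exists w; split=> //.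
by apply: eB; rewrite -ball_normE.
Qed.

Let tensor_lin a u v : exists w, tensor w = a *: tensor u + tensor v.
Proof.
exists ([seq (a *: p.1, p.2) | p <- u] ++ v).
rewrite /tensor big_cat big_map /=; congr (_ + _).
rewrite scaler_sumr; apply: eq_bigr => -[x y] _.
apply/val_inj/bopE => f.
by rewrite -[LHS]/(f (a *: x) *: y) -[RHS]/(a *: (f x *: y)) linearZ scalerA.
Qed.

Let wittstock_submod_closed : submod_closed wittstock_pred.
Proof.
split=> [|a T S].
  apply/wittstock_predP/subset_closure; exists [::] => //.
  by rewrite /tensor big_nil.
move=> /wittstock_predP/closure_normP cT /wittstock_predP/closure_normP cS.
apply/wittstock_predP/closure_normP => e e0.
have e1 : 0 < e / 2 / (`|a| + 1) by rewrite !divr_gt0// ltr_wpDl.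
have e2 : 0 < e / 2 by rewrite divr_gt0.
have [_ [u _ <-] Tu] := cT _ e1; have [_ [v _ <-] Sv] := cS _ e2.
have [w wE] := tensor_lin a u v; exists (tensor w); first by exists w.
rewrite wE opprD addrACA -scalerBr (le_lt_trans (ler_normD _ _))//.
rewrite [ltRHS]splitr ler_ltD// normrZ.
apply: (@le_trans _ _ (`|a| * (e / 2 / (`|a| + 1)))).
  by rewrite ler_wpM2l// ltW.
by rewrite mulrCA ger_pMr// ler_pdivrMr ?mul1r ?lerDl// ltr_wpDl.
Qed.

HB.instance Definition _ := GRing.isSubmodClosed.Build R
  (regop (dual E) F) wittstock_pred wittstock_submod_closed.
HB.instance Definition _ := [SubChoice_isSubLmodule of wittstock by <:].

Let wnorm (T : wittstock) : R := `|wittstock_val T|.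

Let wnormD T S : wnorm (T + S) <= wnorm T + wnorm S.
Proof. exact: ler_normD. Qed.

Let wnormZ (a : R) T : wnorm (a *: T) = `|a| * wnorm T.
Proof. exact: normrZ. Qed.

Let wnorm_eq0 T : wnorm T = 0 -> T = 0.
Proof. by move=> /normr0_eq0 T0; exact: val_inj. Qed.

HB.instance Definition _ :=
  Lmodule_isNormed.Build R wittstock wnormD wnormZ wnorm_eq0.

Let wle (T S : wittstock) : Prop := wittstock_val T <=v wittstock_val S.

Let wle_refl T : wle T T. Proof. exact: lev_refl. Qed.

Let wle_anti T S : wle T S -> wle S T -> T = S.
Proof. by move=> TS ST; apply/val_inj/lev_anti. Qed.

Let wle_trans S T U : wle T S -> wle S U -> wle T U.
Proof. exact: lev_trans. Qed.

Let wle_add2r U T S : wle T S -> wle (T + U) (S + U).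
Proof. exact: lev_add2r. Qed.

Let wle_scale (a : R) T S : 0 <= a -> wle T S -> wle (a *: T) (a *: S).
Proof. exact: lev_scale. Qed.

HB.instance Definition _ := isOrderedLmodule.Build R wittstock
  wle_refl wle_anti wle_trans wle_add2r wle_scale.

End wittstock.
Arguments wittstock {R} E F.


Section c0_space.
Variable R : realType.

Definition c0_pred : {pred nat -> R^o} :=
  [pred u | `[< u n @[n --> \oo] --> (0 : R^o) >]].

Lemma c0_predP (u : nat -> R^o) :
  reflect (u n @[n --> \oo] --> (0 : R^o)) (u \in c0_pred).
Proof. by rewrite unfold_in; exact: asboolP. Qed.

Record c0 := C0 { c0_seq :> nat -> R^o ; c0P : c0_seq \in c0_pred }.

HB.instance Definition _ := [isSub for c0_seq].
HB.instance Definition _ := [Choice of c0 by <:].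

Let c0_submod_closed : submod_closed c0_pred.
Proof.
split=> [|a u v].
  by apply/c0_predP; exact: cvg_cst.
move=> /c0_predP u0 /c0_predP v0; apply/c0_predP.
have -> : (0 : R^o) = a *: 0 + 0 by rewrite scaler0 addr0.
by apply: cvgD => //; exact: cvgZr.
Qed.

HB.instance Definition _ :=
  GRing.isSubmodClosed.Build R (nat -> R^o) c0_pred c0_submod_closed.
HB.instance Definition _ := [SubChoice_isSubLmodule of c0 by <:].

Definition c0_norm (u : c0) : R := sup (range (fun n => `|u n|)).

Let c0_has_sup (u : c0) : has_sup (range (fun n => `|u n|)).
Proof.
split; first by exists `|u 0%N|; exists 0%N.
have /c0_predP u0 := c0P u.
have : cvgn u by apply/cvg_ex; exists 0.
move=> /cvg_seq_bounded/pinfty_ex_gt0[M M0 uM].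
by exists M => _ [n _ <-]; exact: uM.
Qed.

Let c0_norm_ge (u : c0) n : `|u n| <= c0_norm u.
Proof. by apply: sup_upper_bound => //; exists n. Qed.

Let c0_norm_le (u : c0) (M : R) : (forall n, `|u n| <= M) -> c0_norm u <= M.
Proof.
move=> uM; apply: ge_sup; first by have [] := c0_has_sup u.
by move=> _ [n _ <-].
Qed.

Let c0_normD u v : c0_norm (u + v) <= c0_norm u + c0_norm v.
Proof.
by apply: c0_norm_le => n; rewrite (le_trans (ler_normD _ _))// lerD.
Qed.

Let c0_normZ_le (a : R) u : c0_norm (a *: u) <= `|a| * c0_norm u.
Proof. by apply: c0_norm_le => n; rewrite normrZ ler_wpM2l. Qed.

Let c0_normZ (a : R) u : c0_norm (a *: u) = `|a| * c0_norm u.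
Proof.
apply/eqP; rewrite eq_le c0_normZ_le /=.
have [->|a0] := eqVneq a 0.
  by rewrite normr0 mul0r; apply: le_trans (c0_norm_ge _ 0%N).
rewrite -ler_pdivlMl ?normr_gt0//.
have := c0_normZ_le a^-1 (a *: u).
by rewrite scalerA mulVf// scale1r normfV.
Qed.

Let c0_norm_eq0 u : c0_norm u = 0 -> u = 0.
Proof.
move=> u0; apply/val_inj/funext => n; apply/eqP; rewrite -normr_le0 -u0.
exact: c0_norm_ge.
Qed.

HB.instance Definition _ :=
  Lmodule_isNormed.Build R c0 c0_normD c0_normZ c0_norm_eq0.

End c0_space.

Section properties.
Variable R : realType.

Definition finite_rank (V W : lmodType R) (f : V -> W) : Prop :=
  exists (n : nat) (e : 'I_n -> W),
    forall x, exists c : 'I_n -> R, f x = \sum_(i < n) c i *: e i.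

Definition infinite_dimensional (V : lmodType R) : Prop :=
  ~ finite_rank (@idfun V).

(* J is a linear homeomorphism from c0 onto Z, with inverse K on Z. *)
Definition c0_copy (X : normedModType R) (Z : set X) : Prop :=
  closed Z /\
  exists (J : bop (c0 R) X) (K : X -> c0 R),
    [/\ range J = Z, cancel J K & {within Z, continuous K}].

Definition contains_c0 (X : normedModType R) : Prop :=
  exists Z : set X, c0_copy Z.

Definition contains_complemented_c0 (X : normedModType R) : Prop :=
  exists2 Z : set X, c0_copy Z &
    exists2 P : bop X X, range P = Z & forall x, P (P x) = P x.

Definition BPAP (X : banachLatticeType R) : Prop :=
  exists2 lambda : R, 1 <= lambda &
    forall (C : set X) (eps : R), compact C -> 0 < eps ->
      exists T : bop X X, [/\ finite_rank T, positive T, `|T| <= lambda &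
        forall x, C x -> `|x - T x| <= eps].

Definition weakly_null (X : normedModType R) (x : nat -> X) : Prop :=
  forall f : dual X, f (x n) @[n --> \oo] --> (0 : R^o).

Definition weakstar_null (X : normedModType R) (f : nat -> dual X) : Prop :=
  forall x : X, f n x @[n --> \oo] --> (0 : R^o).

Definition grothendieck (X : normedModType R) : Prop :=
  forall f : nat -> dual X, weakstar_null f -> weakly_null f.

Definition positive_grothendieck (X : orderedNormedModType R) : Prop :=
  forall f : nat -> dual X, (forall n, positive (f n)) ->
    weakstar_null f -> weakly_null f.

Definition reflexive_space (X : normedModType R) : Prop :=
  forall phi : dual (dual X), exists x : X, forall f : dual X, phi f = f x.

End properties.

(* Main.v *)
Require Import Defs.
From mathcomp Require Import all_boot all_order all_algebra.
From mathcomp Require Import boolp classical_sets functions reals topology.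
From mathcomp Require Import normedtype sequences.
From mathcomp Require Import lra ring.

(** Write W for the Wittstock tensor product; its elements are operators T from
    the dual of E to F. A complemented copy of c0 in W is produced from two
    ingredients.

    In E: a Banach lattice that contains c0 contains a sequence of positive
    vectors e_k with bounded partial sums and almost biorthogonal positive
    functionals f_k ([contains_c0_positive]); Hahn-Banach turns the f_k into an
    exactly biorthogonal bounded sequence h_k ([biorthogonal_functionals]). As
    the e_k are positive, sum_k |xi (e_k)| is at most a multiple of the norm of
    xi, for xi in the dual of E. Hence every null sequence z in F defines an
    operator xi |-> sum_k xi (e_k) z_k in W, of regular norm at most a multiple
    of the supremum of the norms of the z_k ([series_wittstock]): the modulus is
    dominated by the same series with |z_k|.

    In F: the dual of an infinite dimensional lattice contains, for every n,
    finitely many functionals g_(n,j) whose norms sum up to at most 2 while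
    sum_j t_j g_(n,j) has norm at most 1/(n+1) for all multipliers with |t_j| <= 1
    and sum_j g_(n,j)(y_(n,j)) = 1 for suitable y_(n,j) in the unit ball of F
    ([exists_spread_family]). These families replace a weak-star null normalized
    sequence of functionals on F, so that the Josefson-Nissenzweig theorem is
    avoided.

    Reindex the sequence e by the pairs (n,j). The map J sends a in c0 to the
    operator given by the null sequence z_(n,j) = a_n y_(n,j), and phi_n is the
    functional T |-> sum_j g_(n,j)(T h_(n,j)). Then phi_n (J a) = a_n, and
    phi_n tends to 0 pointwise on W: on an elementary tensor of x and v it is
    (sum_j h_(n,j)(x) g_(n,j))(v), which is O(1/n), and the phi_n are uniformly
    bounded.
    So T |-> J (phi_n T)_n is a projection onto a copy of c0. The phi_n are
    weak-star null, but not weakly null, because a limit of the bounded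
    sequence J (1,...,1,0,...) in the bidual of W takes the value 1 at each of
    them; so W is not a Grothendieck space.

    When F is reflexive the g_(n,j) and the y_(n,j) can be taken positive
    ([exists_positive_spread_family]). Replacing h by the positive functionals
    f yields positive phi_n which are weak-star null and still bounded below on
    J (1,...,1,0,...) for long initial segments, so the positive Grothendieck
    property fails too. *)

Set Implicit Arguments.
Unset Strict Implicit.
Unset Printing Implicit Defensive.

Import Order.TTheory GRing.Theory Num.Theory.
Import numFieldNormedType.Exports.

Local Open Scope classical_set_scope.
Local Open Scope ring_scope.

(** * The Hahn-Banach theorem *)
Section hahn_banach.
Variables (R : realType) (V : lmodType R).
Implicit Types (p q : V -> R) (D : set (V * R)).

Definition sublinear p :=
  (forall x y, p (x + y) <= p x + p y) /\
  (forall t x, 0 < t -> p (t *: x) <= t * p x).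

(** A pair (d, r) in D stands for the constraint that a functional be at least r
    at d; a functional meeting two constraints also meets their sum. *)
Definition convex_cone D :=
  [/\ D (0, 0), forall d e, D d -> D e -> D (d.1 + e.1, d.2 + e.2) &
      forall t d, 0 < t -> D d -> D (t *: d.1, t * d.2)].

Lemma sublinear0 p : sublinear p -> 0 <= p 0.
Proof. by move=> [pD _]; have := pD 0 0; rewrite addr0 -subr_ge0 addrK. Qed.

Lemma sublinear_geN p x : sublinear p -> - p (- x) <= p x.
Proof.
move=> sp; have := sublinear0 sp; have := sp.1 x (- x); rewrite subrr.
by move=> h1 h2; rewrite -subr_ge0 opprK (le_trans h2).
Qed.

(** The largest sublinear functional below p whose linear minorants f satisfy
    r <= f d for all (d, r) in D: indeed r - f d = f (- d) + r <= 0. *)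
Definition lower_by D p x : R := inf [set p (x + d.1) - d.2 | d in D].

Section lower_by.
Variables (D : set (V * R)) (p : V -> R).
Hypotheses (cD : convex_cone D) (sp : sublinear p).
Hypothesis Dp : forall d, D d -> d.2 <= p d.1.

Let lower_by_has x : has_inf [set p (x + d.1) - d.2 | d in D].
Proof.
have [D0 _ _] := cD; split; first by exists (p (x + 0) - 0), (0, 0).
exists (- p (- x)) => _ [d Dd <-]; have := sp.1 (- x) (x + d.1).
by rewrite addKr => h; have := Dp Dd; lra.
Qed.

Let lower_by_le x d : D d -> lower_by D p x <= p (x + d.1) - d.2.
Proof. by move=> Dd; apply: ge_inf; [have [] := lower_by_has x|exists d]. Qed.

Let lower_by_ge x M : (forall d, D d -> M <= p (x + d.1) - d.2) ->
  M <= lower_by D p x.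
Proof.
move=> DM; apply: lb_le_inf; first by have [] := lower_by_has x.
by move=> _ [d Dd <-]; exact: DM.
Qed.

Lemma lower_by_sublinear : sublinear (lower_by D p).
Proof.
have [D0 DD DZ] := cD; split=> [x y|t x t0].
  rewrite -lerBlDr; apply: lower_by_ge => d Dd.
  rewrite lerBlDr -lerBlDl; apply: lower_by_ge => e De.
  rewrite lerBlDr; apply: le_trans (lower_by_le _ (DD _ _ De Dd)) _ => /=.
  have := sp.1 (x + d.1) (y + e.1); rewrite addrACA [d.1 + e.1]addrC => h.
  by lra.
rewrite -ler_pdivrMl//; apply: lower_by_ge => d Dd.
rewrite ler_pdivrMl//; apply: le_trans (lower_by_le _ (DZ _ _ t0 Dd)) _ => /=.
by rewrite -scalerDr mulrBr lerB// sp.2.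
Qed.

Lemma lower_by_le_self x : lower_by D p x <= p x.
Proof.
by have [D0 _ _] := cD; apply: le_trans (lower_by_le _ D0) _; rewrite /= addr0 subr0.
Qed.

Lemma lower_by_cone d : D d -> lower_by D p (- d.1) <= - d.2.
Proof.
move=> Dd; apply: le_trans (lower_by_le _ Dd) _; rewrite addNr gerDr.
have := sp.2 2^-1 0; rewrite scaler0 invr_gt0 => /(_ (ltr0Sn R 1)).
by lra.
Qed.

End lower_by.

(** Zorn's lemma is applied to total sublinear functionals instead of to
    partially defined linear ones; a chain has its pointwise infimum as a lower
    bound, since every member lies above x |-> - p (- x). *)
Lemma minimal_sublinear p : sublinear p ->
  exists q, [/\ sublinear q, forall x, q x <= p x &
    forall q', sublinear q' -> (forall x, q' x <= q x) -> forall x, q x <= q' x].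
Proof.
move=> sp.
pose T := {q : V -> R | sublinear q /\ forall x, q x <= p x}.
pose r (q q' : T) : bool := `[< forall x, sval q' x <= sval q x >].
have [|a b c|a b|A Atot|q qmin] := @Zorn T r.
- by move=> t; apply/asboolP.
- move=> /asboolP ab /asboolP bc; apply/asboolP => x.
  exact: le_trans (bc x) (ab x).
- case: a b => [a ?] [b ?] /asboolP /= ab /asboolP /= ba; apply: eq_exist.
  by apply/funext => x; apply/eqP; rewrite eq_le ab ba.
- have [[a0 Aa0]|A0] := pselect (exists a, A a); last first.
    by exists (exist _ p (conj sp (fun x => lexx _))) => s As; case: A0; exists s.
  pose q x := inf [set sval a x | a in A].
  have qinf x : has_inf [set sval a x | a in A].
    split; first by exists (sval a0 x), a0.
    exists (- p (- x)) => _ [a Aa <-]; have [sa ap] := svalP a.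
    by apply: le_trans (sublinear_geN x sa); rewrite lerN2.
  have qle a x : A a -> q x <= sval a x.
    by move=> Aa; apply: ge_inf; [have [] := qinf x|exists a].
  have qge x M : (forall a, A a -> M <= sval a x) -> M <= q x.
    move=> AM; apply: lb_le_inf; first by have [] := qinf x.
    by move=> _ [a Aa <-]; exact: AM.
  have sq : sublinear q.
    split=> [x y|t x t0].
      rewrite -lerBlDr; apply: (qge) => a Aa.
      rewrite lerBlDr -lerBlDl; apply: (qge) => b Ab.
      rewrite lerBlDr.
      have [/asboolP ab|/asboolP ba] := Atot _ _ Aa Ab.
        apply: le_trans (qle _ _ Ab) _; apply: le_trans ((svalP b).1.1 _ _) _.
        by rewrite addrC lerD.
      apply: le_trans (qle _ _ Aa) _; apply: le_trans ((svalP a).1.1 _ _) _.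
      by rewrite addrC lerD.
    rewrite -ler_pdivrMl//; apply: qge => a Aa; rewrite ler_pdivrMl//.
    by apply: le_trans (qle _ _ Aa) _; apply: (svalP a).1.2.
  have qp x : q x <= p x by apply: le_trans (qle _ _ Aa0) _; apply: (svalP a0).2.
  exists (exist _ q (conj sq qp)) => s As; apply/asboolP => x /=.
  exact: qle.
exists (sval q); have [sq qp] := svalP q; split=> // q' sq' q'q x.
have q'p y : q' y <= p y by exact: le_trans (qp y).
have := qmin (exist _ q' (conj sq' q'p)); move=> <- //.
by apply/asboolP.
Qed.

(** A minimal sublinear functional q is linear: lowering q along the ray
    spanned by (y, q y) gives a sublinear functional below q, hence q itself, and
    this reads q x + q y <= q (x + y). *)
Lemma sublinear_minorant p : sublinear p ->
  exists2 f : V -> R, (forall a x y, f (a *: x + y) = a * f x + f y) &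
    forall x, f x <= p x.
Proof.
move=> /minimal_sublinear[q [sq qp qmin]]; exists q => //.
have q0 : q 0 = 0.
  apply/eqP; rewrite eq_le sublinear0// andbT.
  by have := sq.2 2^-1 0; rewrite scaler0 invr_gt0 => /(_ (ltr0Sn R 1)); lra.
have qZ t x : 0 < t -> q (t *: x) = t * q x.
  move=> t0; apply/eqP; rewrite eq_le sq.2//= -ler_pdivlMl//.
  by rewrite -[in leLHS](scale1r x) -(mulVf (lt0r_neq0 t0)) -scalerA sq.2// invr_gt0.
have qD x y : q (x + y) = q x + q y.
  apply/eqP; rewrite eq_le sq.1 /=.
  (* Equality at y is imposed from below only: q y is already an upper bound. *)
  pose D : set (V * R) := [set d | exists2 t, 0 <= t & d = (t *: y, t * q y)].
  have cD : convex_cone D.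
    split=> [|_ _ [s s0 ->] [t t0 ->]|t _ t0 [s s0 ->]].
    - by exists 0; rewrite ?scale0r ?mul0r.
    - by exists (s + t); rewrite ?addr_ge0// scalerDl mulrDl.
    - by exists (t * s); rewrite ?mulr_ge0 ?(ltW t0)// scalerA mulrA.
  have Dq d : D d -> d.2 <= q d.1.
    move=> [t + ->] /=; rewrite le_eqVlt => /predU1P[<-|t0].
      by rewrite scale0r mul0r q0.
    by rewrite qZ.
  rewrite -lerBrDr.
  apply: le_trans (qmin _ (lower_by_sublinear cD sq Dq) (lower_by_le_self cD sq Dq) x) _.
  apply: ge_inf; last by exists (y, q y) => //; exists 1; rewrite ?scale1r ?mul1r.
  exists (- q (- x)) => _ [d Dd <-]; have := sq.1 (- x) (x + d.1).
  by rewrite addKr => h; have := Dq _ Dd; lra.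
have qN x : q (- x) = - q x by apply/eqP; rewrite -addr_eq0 addrC -qD subrr q0.
move=> a x y; rewrite qD; congr (_ + _).
have [a0|a0|a0] := ltgtP a 0; last 2 first.
- exact: qZ.
- by rewrite a0 scale0r mul0r q0.
by rewrite -[a]opprK scaleNr qN qZ ?oppr_gt0// !mulNr.
Qed.

End hahn_banach.

Section cone_separation.
Variables (R : realType) (V : normedModType R).

Lemma normed_sublinear (C : R) : 0 <= C -> sublinear (fun x : V => C * `|x|).
Proof.
move=> C0; split=> [x y|t x t0]; first by rewrite -mulrDr ler_wpM2l// ler_normD.
by rewrite normrZ gtr0_norm// mulrCA.
Qed.

(** The form in which Hahn-Banach is used everywhere below: lower bounds on a
    functional that are additive and homogeneous can be met with norm C as soon
    as C allows each of them separately. *)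
Lemma cone_separation (D : set (V * R)) (C : R) : 0 <= C -> convex_cone D ->
  (forall d, D d -> d.2 <= C * `|d.1|) ->
  exists2 f : dual V, `|f| <= C & forall d, D d -> d.2 <= f d.1.
Proof.
move=> C0 cD DC; have sC := normed_sublinear C0.
have [f lf fp] := sublinear_minorant (lower_by_sublinear cD sC DC).
have fC x : f x <= C * `|x| by apply: le_trans (fp x) (lower_by_le_self cD sC DC x).
have f0 : f 0 = 0.
  by have := lf (-1) 0 0; rewrite scaler0 addr0 mulN1r addNr.
have fN x : f (- x) = - f x.
  by have := lf (-1) x 0; rewrite scaleN1r !addr0 mulN1r f0 addr0.
have fC' (x : V) : `|(f : V -> R^o) x| <= C * `|x|.
  rewrite ler_norml fC andbT lerNl -fN (le_trans (fC _))//.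
  by rewrite normrN.
have fb := bop_bound (lf : linear (f : V -> R^o)) fC'.
exists (Bop fb); first exact: bop_norm_le.
move=> d Dd /=; rewrite -lerN2 -fN.
by apply: le_trans (fp _) (lower_by_cone cD sC DC Dd).
Qed.

End cone_separation.

(** * Positive functionals on a Banach lattice *)
Section positive_functionals.
Variables (R : realType) (V : banachLatticeType R).
Implicit Types (x y z : V) (f g : dual V).

Lemma posv_mono x y : x <=v y -> posv x <=v posv y.
Proof.
move=> xy; apply: joinv_le; last exact: posv_ge0.
exact: lev_trans xy (posv_ge y).
Qed.

Lemma norm_posv_le x : `|posv x| <= `|x|.
Proof. by rewrite -(norm_absv x); apply: normv_le; [exact: posv_ge0|exact: posv_le]. Qed.

Lemma posv_eq0 x : posv x = 0 -> x <=v 0.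
Proof. by move=> <-; exact: posv_ge. Qed.

Lemma posvZ (a : R) x : 0 <= a -> posv (a *: x) = a *: posv x.
Proof.
move=> a0; have le b y : 0 <= b -> posv (b *: y) <=v b *: posv y.
  move=> b0; apply: joinv_le; first by apply: lev_scale => //; exact: posv_ge.
  by apply: scalev_ge0 => //; exact: posv_ge0.
move: a0; rewrite le_eqVlt => /predU1P[<-|a0].
  by rewrite !scale0r posv_id//; exact: lev_refl.
apply: lev_anti; first exact/le/ltW.
have ai : 0 <= a^-1 by rewrite invr_ge0 ltW.
have /(lev_scale (ltW a0)) := le a^-1 (a *: x) ai.
by rewrite !scalerA mulVf ?mulfV ?gt_eqF// !scale1r.
Qed.

(** The positive cone is closed, because the positive part is norm-decreasing. *)
Lemma lev_approx x y a : (forall e : R, 0 < e -> x <=v y + e *: a) -> x <=v y.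
Proof.
move=> H; suff : posv (x - y) = 0.
  by move=> /posv_eq0/(lev_add2r y); rewrite subrK add0r.
apply/eqP; rewrite -normr_eq0 eq_le normr_ge0 andbT.
apply/ler_addgt0Pr => e e0; rewrite add0r.
have a1 : 0 < `|a| + 1 by rewrite ltr_wpDl.
have d0 : 0 < e / (`|a| + 1) by rewrite divr_gt0.
have le : x - y <=v (e / (`|a| + 1)) *: a.
  by have := lev_add2r (- y) (H _ d0); rewrite addrAC subrr add0r.
apply: (le_trans (normv_le (posv_ge0 _) (posv_mono le))).
rewrite (le_trans (norm_posv_le _))// normrZ gtr0_norm//.
by rewrite mulrAC ler_pdivrMr// ler_pM2l// lerDl.
Qed.

Lemma positive_mono f x y : positive f -> x <=v y -> f x <= f y.
Proof.
move=> pf /lev_subr/pf; rewrite linearB /lev /= => h.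
by rewrite -subr_ge0.
Qed.

Lemma positive_ge0 f x : positive f -> 0 <=v x -> 0 <= f x.
Proof. by move=> pf x0; exact: (pf x x0). Qed.

Lemma positive_abs f x : positive f -> `|f x| <= f (absv x).
Proof.
move=> pf; rewrite ler_norml lerNl -linearN; apply/andP.
by split; apply: positive_mono => //; [exact: absv_geN|exact: absv_ge].
Qed.

Lemma dual_absv_le f x : `|f x| <= absv f (absv x).
Proof.
have pf : positive (absv f) by apply/bop_ge0P/absv_ge0.
have h y : 0 <=v y -> `|f y| <= absv f y.
  move=> y0; have /bop_leP/(_ _ y0) := absv_ge f; have /bop_leP/(_ _ y0) := absv_geN f.
  by rewrite /lev /= => h1 h2; rewrite ler_norml lerNl h1 h2.
have yp : 0 <=v (2^-1 : R) *: (absv x + x).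
  apply: scalev_ge0; rewrite ?invr_ge0//.
  by have := (lev_subr _ _).1 (absv_geN x); rewrite opprK.
have yn : 0 <=v (2^-1 : R) *: (absv x - x).
  by apply: scalev_ge0; rewrite ?invr_ge0//; apply: (lev_subr _ _).1; exact: absv_ge.
have e1 : x = (2^-1 : R) *: (absv x + x) - (2^-1 : R) *: (absv x - x).
  by rewrite -scalerBr opprB [absv x + x]addrC addrACA subrr addr0 scalerDr -scalerDl -[2^-1]div1r -splitr scale1r.
have e2 : absv x = (2^-1 : R) *: (absv x + x) + (2^-1 : R) *: (absv x - x).
  by rewrite -scalerDr addrACA subrr addr0 scalerDr -scalerDl -[2^-1]div1r -splitr scale1r.
move: e1 e2 yp yn; set u := _ *: _; set v := _ *: _; move: u v => u v e1 e2 u0 v0.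
rewrite e2 e1 linearB linearD (le_trans (ler_normB _ _))// lerD//; exact: h.
Qed.

(** Positivity and the bound at x are constraints of a single cone: it consists
    of the (u, t |x^+|) with t x <= u, and t x <= u implies t x^+ <= u^+, hence t |x^+| <= |u| in norm. *)
Lemma norming_positive x : exists g,
  [/\ positive g, `|g| <= 1 & `|posv x| <= g x].
Proof.
pose D : set (V * R) := [set d | exists2 t, 0 <= t &
  t *: x <=v d.1 /\ d.2 = t * `|posv x|].
have [|[u r] [t t0 /= [xu ->]]|g g1 gD] := @cone_separation _ _ D 1 ler01.
- split=> [|[u _] [v _] [s s0 /= [xu ->]] [t t0 /= [xv ->]]|c [u _] c0 [s s0 /= [xu ->]]].
  + by exists 0; rewrite ?scale0r ?mul0r//=; split=> //; exact: lev_refl.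
  + exists (s + t); rewrite ?addr_ge0//=; split; last by rewrite mulrDl.
    by rewrite scalerDl; exact: lev_add.
  + exists (c * s); rewrite ?mulr_ge0 ?(ltW c0)//=; split; last by rewrite mulrA.
    by rewrite -scalerA; apply: lev_scale => //; exact: ltW.
- rewrite mul1r -(ger0_norm t0) -normrZ -posvZ//.
  by apply: le_trans (norm_posv_le u); apply: normv_le (posv_mono xu); exact: posv_ge0.
exists g; split=> //.
  move=> u u0; apply: (gD (u, 0)); exists 0 => //=.
  by rewrite scale0r mul0r.
apply: (gD (x, `|posv x|)); exists 1 => //=.
by rewrite scale1r mul1r; split => //; exact: lev_refl.
Qed.

(** The bipolar theorem for the positive cone. *)
Lemma lev_dual x y : (forall g, positive g -> `|g| <= 1 -> g x <= g y) -> x <=v y.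
Proof.
move=> H; have [g [pg g1]] := norming_positive (x - y).
rewrite linearB => gxy; have {}gxy : `|posv (x - y)| <= 0.
  by apply: le_trans gxy _; rewrite subr_le0 H.
move: gxy; rewrite normr_le0 => /eqP/posv_eq0/(lev_add2r y).
by rewrite subrK add0r.
Qed.

End positive_functionals.

(** A weak-star limit point of T, obtained from Hahn-Banach: the constraints
    r <= t x that hold for T n x when n is large form a convex cone. The
    bounds from above follow by applying the conclusion to - x. *)
Lemma dual_limit (R : realType) (V : normedModType R) (T : nat -> dual V) (C : R) :
  (forall n, `|T n| <= C) -> exists2 t : dual V, `|t| <= C &
  forall x r, (\forall n \near \oo, r <= T n x) -> r <= t x.
Proof.
move=> TC; have C0 : 0 <= C by apply: le_trans (TC 0%N).
pose D : set (V * R) := [set d | \forall n \near \oo, d.2 <= T n d.1].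
have [|[x r] [N _ H]|t tC tD] := @cone_separation _ _ D C C0.
- split=> [|[u r] [v s] /= Du Dv|c [u r] c0 /= Du].
  + by apply: nearW => n /=; rewrite linear0.
  + rewrite /D /=; near=> n; rewrite linearD.
    by apply: lerD; [near: n; exact: Du|near: n; exact: Dv].
  + rewrite /D /=; near=> n; rewrite linearZ /=.
    by apply: (ler_wpM2l (ltW c0)); near: n; exact: Du.
- rewrite /= (le_trans (H N _))//= (le_trans (ler_norm _))//.
  by rewrite (le_trans (opnormP _ _))// ler_wpM2r.
by exists t => // x r Dx; exact: (tD (x, r)).
Unshelve. all: by end_near. Qed.

(** * Disjoint sequences *)
Section disjointness.
Variables (R : realType) (V : banachLatticeType R).
Implicit Types (x y z u v w a : V).

Lemma opp_lev u : 0 <=v u -> - u <=v u.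
Proof. by move=> u0; apply: lev_trans (u0); have := lev_opp u0; rewrite oppr0. Qed.

(** For positive u and v this says that their infimum vanishes; stating it
    without infima makes it stable under sums by Riesz decomposition. *)
Definition disjoint u v := forall z, 0 <=v z -> z <=v u -> z <=v v -> z = 0.

Lemma disjointC u v : disjoint u v -> disjoint v u.
Proof. by move=> uv z z0 zv zu; exact: uv. Qed.

Lemma disjoint_le u v u' v' : u' <=v u -> v' <=v v -> disjoint u v -> disjoint u' v'.
Proof. by move=> uu vv uv z z0 zu zv; exact: uv z0 (lev_trans zu uu) (lev_trans zv vv). Qed.

Lemma disjointD u v w : 0 <=v u -> 0 <=v v -> disjoint u w -> disjoint v w ->
  disjoint (u + v) w.
Proof.
move=> u0 v0 uw vw z z0 zuv zw.
have [z1 [z2 [e z10 z1u z20 z2v]]] := riesz u0 v0 z0 zuv.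
have z1z : z1 <=v z by rewrite e -{1}[z1]addr0; apply: lev_add => //; exact: lev_refl.
have z2z : z2 <=v z by rewrite e -{1}[z2]add0r; apply: lev_add => //; exact: lev_refl.
by rewrite e (uw _ z10 z1u (lev_trans z1z zw)) (vw _ z20 z2v (lev_trans z2z zw)) addr0.
Qed.

Lemma disjointZ (c : R) u v : 0 <= c -> 0 <=v u -> disjoint u v -> disjoint (c *: u) v.
Proof.
move=> c0 u0 uv z z0 zu zv; pose b := c + 1.
have b1 : 1 <= b by rewrite lerDr.
have b0 : 0 < b by apply: lt_le_trans b1.
have bi : 0 <= b^-1 by rewrite invr_ge0 ltW.
have /eqP : b^-1 *: z = 0.
  apply: uv; first exact: scalev_ge0.
    have : z <=v b *: u.
      apply: lev_trans zu _; apply: (lev_subr _ _).2; rewrite -scalerBl.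
      by apply: scalev_ge0 => //; rewrite subr_ge0 lerDl.
    by move=> /(lev_scale bi); rewrite scalerA mulVf ?scale1r// gt_eqF.
  apply: lev_trans zv; rewrite -[X in _ <=v X]scale1r; apply: (lev_subr _ _).2.
  by rewrite -scalerBl; apply: scalev_ge0 => //; rewrite subr_ge0 invf_le1.
by rewrite scaler_eq0 invr_eq0 gt_eqF//= => /eqP.
Qed.

Lemma sumv_ge0 (I : Type) (r : seq I) (P : pred I) (h : I -> V) :
  (forall i, P i -> 0 <=v h i) -> 0 <=v \sum_(i <- r | P i) h i.
Proof. by move=> h0; apply: big_ind => //; [exact: lev_refl|move=> s t; exact: addv_ge0]. Qed.

Lemma disjoint_sum (I : Type) (r : seq I) (P : pred I) (h : I -> V) w :
  (forall i, P i -> 0 <=v h i) -> (forall i, P i -> disjoint (h i) w) ->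
  disjoint (\sum_(i <- r | P i) h i) w.
Proof.
move=> h0 hw; suff [] : 0 <=v \sum_(i <- r | P i) h i /\
    disjoint (\sum_(i <- r | P i) h i) w by [].
apply: (big_ind (fun s => 0 <=v s /\ disjoint s w)) => //.
- by split; [exact: lev_refl|move=> z z0 zz _; exact: lev_anti].
- by move=> s t [s0 sw] [t0 tw]; split; [exact: addv_ge0|exact: disjointD].
- by move=> i Pi; split; [exact: h0|exact: hw].
Qed.

Lemma disjoint_posv u : disjoint (posv u) (posv (- u)).
Proof.
move=> z z0 zu zn; apply: lev_anti => //.
have : posv u <=v posv u - z.
  apply: joinv_le; last exact: (lev_subr _ _).1.
  have := lev_add (lev_refl (posv u)) (lev_opp zn); rewrite posvBN => h.
  by have := h.
by move=> /(lev_add2r (z - posv u)); rewrite addrC subrK addrC addrA subrK subrr.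
Qed.

Lemma disjoint_addv_le u v x : 0 <=v u -> 0 <=v v -> disjoint u v ->
  u <=v x -> v <=v x -> u + v <=v x.
Proof.
move=> u0 v0 uv ux vx; suff -> : u + v = joinv u v by exact: joinv_le.
apply/eqP; rewrite -subr_eq0; apply/eqP/uv.
- apply: (lev_subr _ _).1; apply: joinv_le.
    by rewrite -{1}[u]addr0; apply: lev_add => //; exact: lev_refl.
  by rewrite -{1}[v]add0r; apply: lev_add => //; exact: lev_refl.
- have := lev_add (lev_refl (u + v)) (lev_opp (leUvr u v)).
  by rewrite addrK.
- have := lev_add (lev_refl (u + v)) (lev_opp (leUvl u v)).
  by rewrite [u + v - u]addrC addKr.
Qed.

(** With z = u + v - |u - v|, half of z lies below u and below v. *)
Lemma disjoint_absvB u v : 0 <=v u -> 0 <=v v -> disjoint u v ->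
  u + v <=v absv (u - v).
Proof.
move=> u0 v0 uv; have h2 : (0 : R) <= 2^-1 by rewrite invr_ge0.
have half x : (2^-1 : R) *: (x + x) = x.
  by rewrite scalerDr -scalerDl -[2^-1]div1r -splitr scale1r.
pose z := (2^-1 : R) *: (u + v - absv (u - v)).
have z0 : z = 0.
  apply: uv.
  - apply: scalev_ge0 => //; apply: (lev_subr _ _).1; apply: absv_le.
      by apply: lev_add; [exact: lev_refl|exact: opp_lev].
    by rewrite opprB addrC; apply: lev_add; [exact: opp_lev|exact: lev_refl].
  - rewrite -[X in _ <=v X]half; apply: lev_scale => //.
    have := lev_add (lev_refl (u + v)) (lev_opp (absv_geN (u - v))).
    by rewrite opprK addrACA subrr addr0.
  - rewrite -[X in _ <=v X]half; apply: lev_scale => //.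
    have := lev_add (lev_refl (u + v)) (lev_opp (absv_ge (u - v))).
    have -> // : u + v - (u - v) = v + v by rewrite opprB addrC addrA subrK.
have : (2 : R) *: z = 0 by rewrite z0 scaler0.
rewrite scalerA mulfV ?scale1r ?pnatr_eq0// => /eqP; rewrite subr_eq0 => /eqP ->.
exact: lev_refl.
Qed.

(** Positive and negative coefficients give two disjoint partial sums. *)
Lemma disjoint_abs_sum (I : finType) (h : I -> V) (c : I -> R) :
  (forall i, 0 <=v h i) -> (forall i j, i != j -> disjoint (h i) (h j)) ->
  \sum_i `|c i| *: h i <=v absv (\sum_i c i *: h i).
Proof.
move=> h0 hd; pose P i := 0 <= c i.
have t0 i : 0 <=v `|c i| *: h i by exact: scalev_ge0.
have td i j : P i -> ~~ P j -> disjoint (`|c i| *: h i) (`|c j| *: h j).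
  move=> Pi Pj; apply: disjointZ => //; apply/disjointC/disjointZ => //.
  by apply: hd; apply: contraNneq Pj => ->.
have p0 : 0 <=v \sum_(i | P i) `|c i| *: h i by apply: sumv_ge0 => i _; exact: t0.
have q0 : 0 <=v \sum_(i | ~~ P i) `|c i| *: h i by apply: sumv_ge0 => i _; exact: t0.
have pq : disjoint (\sum_(i | P i) `|c i| *: h i) (\sum_(i | ~~ P i) `|c i| *: h i).
  apply: disjoint_sum => // i Pi; apply/disjointC/disjoint_sum => // j Pj.
  exact/disjointC/td.
rewrite [X in X <=v _](bigID P) [X in absv X](bigID P) /=.
have -> : \sum_(i | P i) c i *: h i = \sum_(i | P i) `|c i| *: h i.
  by apply: eq_bigr => i Pi; rewrite ger0_norm.
have -> : \sum_(i | ~~ P i) c i *: h i = - \sum_(i | ~~ P i) `|c i| *: h i.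
  rewrite -sumrN; apply: eq_bigr => i; rewrite /P -ltNge => ci.
  by rewrite ltr0_norm// scaleNr opprK.
exact: disjoint_absvB.
Qed.

(** Atoms play the part of coordinate directions: the interval below an atom is a
    segment ([sub_atom]). *)
Definition atom a := [/\ 0 <=v a, a <> 0 & forall u v, 0 <=v u -> 0 <=v v ->
  u <=v a -> v <=v a -> disjoint u v -> u = 0 \/ v = 0].

(** For each m the positive and negative parts of y - m a are disjoint, and both
    are multiples of elements below a, so y is comparable with m a; the
    Archimedean property then pins y down to one multiple of a. *)
Lemma sub_atom a y : atom a -> 0 <=v y -> y <=v a -> exists2 m : R, 0 <= m & y = m *: a.
Proof.
move=> [a0 an aa] y0 ya.
have dich (m : R) : y <=v m *: a \/ m *: a <=v y.
  pose t := `|m| + 1; have t0 : 0 < t by rewrite ltr_wpDl.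
  have ti : 0 <= t^-1 by rewrite invr_ge0 ltW.
  have tle x : x <=v t *: a -> posv (t^-1 *: x) <=v a.
    move=> /(lev_scale ti); rewrite scalerA mulVf ?gt_eqF// scale1r => xa.
    exact: joinv_le.
  have h1 : posv (t^-1 *: (y - m *: a)) <=v a.
    apply: tle; rewrite /t scalerDl scale1r addrC; apply: lev_add => //.
    rewrite -scaleNr; apply: (lev_subr _ _).2; rewrite -scalerBl.
    by apply: scalev_ge0 => //; rewrite subr_ge0 -normrN ler_norm.
  have h2 : posv (t^-1 *: - (y - m *: a)) <=v a.
    apply: tle; rewrite opprB /t scalerDl scale1r; apply: lev_add.
      apply: (lev_subr _ _).2; rewrite -scalerBl.
      by apply: scalev_ge0 => //; rewrite subr_ge0 ler_norm.
    by apply: lev_trans (a0); have := lev_opp y0; rewrite oppr0.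
  have fin x : posv (t^-1 *: x) = 0 -> x <=v 0.
    rewrite posvZ// => /eqP; rewrite scaler_eq0 invr_eq0 gt_eqF//= => /eqP.
    exact: posv_eq0.
  move: h1 h2; rewrite scalerN => h1 h2.
  have [] := aa _ _ (posv_ge0 _) (posv_ge0 _) h1 h2 (@disjoint_posv _).
    by move=> /fin/(lev_add2r (m *: a)); rewrite subrK add0r; left.
  rewrite -scalerN opprB => /fin/(lev_add2r y); rewrite subrK add0r; by right.
pose A := [set m : R | m *: a <=v y].
have na : 0 < `|a| by rewrite normr_gt0; apply/eqP.
have A0 : A 0 by rewrite /A /= scale0r.
have bA m : A m -> m <= 1.
  move=> Am; have [m0|/ltW m0] := leP m 0; first exact: le_trans m0 ler01.
  have := normv_le (scalev_ge0 m0 a0) (lev_trans Am ya).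
  by rewrite normrZ ger0_norm// ger_pMl.
have sA : has_sup A by split; [exists 0|exists 1].
have sge m : A m -> m <= sup A by move=> Am; apply: sup_upper_bound.
exists (sup A); first exact: sge.
apply: lev_anti.
- apply: (lev_approx (a := a)) => e e0; rewrite -scalerDl.
  have [//|/sge] := dich (sup A + e).
  by rewrite gerDl leNgt e0.
- apply: (lev_approx (a := a)) => e e0.
  have [m Am em] := sup_adherent e0 sA.
  apply: (@lev_trans _ _ (m *: a + e *: a)); last exact: lev_add2r.
  rewrite -scalerDl; apply: (lev_subr _ _).2; rewrite -scalerBl.
  by apply: scalev_ge0 => //; rewrite subr_ge0 -lerBlDr ltW.
Qed.

(** Subtract the largest multiple of a that lies below z. *)
Lemma atom_split a z : atom a -> 0 <=v z -> exists c : R,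
  [/\ 0 <=v z - c *: a, z - c *: a <=v z & disjoint (z - c *: a) a].
Proof.
move=> aa z0; have [a0 an _] := aa.
pose A := [set m : R | m *: a <=v z].
have na : 0 < `|a| by rewrite normr_gt0; apply/eqP.
have A0 : A 0 by rewrite /A /= scale0r.
have bA m : A m -> m <= `|z| / `|a|.
  move=> Am; rewrite ler_pdivlMr//; have [m0|/ltW m0] := leP m 0.
    by apply: le_trans (normr_ge0 z); rewrite mulr_le0_ge0.
  by have := normv_le (scalev_ge0 m0 a0) Am; rewrite normrZ ger0_norm.
have sA : has_sup A by split; [exists 0|exists (`|z| / `|a|)].
have sge m : A m -> m <= sup A by move=> Am; apply: sup_upper_bound.
have sz : sup A *: a <=v z.
  apply: (lev_approx (a := a)) => e e0.
  have [m Am em] := sup_adherent e0 sA.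
  apply: (@lev_trans _ _ (m *: a + e *: a)); last exact: lev_add2r.
  rewrite -scalerDl; apply: (lev_subr _ _).2; rewrite -scalerBl.
  by apply: scalev_ge0 => //; rewrite subr_ge0 -lerBlDr ltW.
exists (sup A); split; first exact: (lev_subr _ _).1.
  have := lev_add (lev_refl z) (lev_opp (scalev_ge0 (sge _ A0) a0)).
  by rewrite oppr0 addr0.
move=> y y0 yz ya; have [m m0 e] := sub_atom aa y0 ya.
have /sge : A (sup A + m).
  by rewrite /A /= scalerDl -e addrC; have := lev_add2r (sup A *: a) yz; rewrite subrK.
rewrite gerDl => m0'; have -> : y = 0 *: a by rewrite e; congr (_ *: _); apply/eqP; rewrite eq_le m0 m0'.
by rewrite scale0r.
Qed.

Lemma atoms_split (s : seq V) z : (forall a, a \in s -> atom a) -> 0 <=v z ->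
  exists c : nat -> R, let w := z - \sum_(i < size s) c i *: nth 0 s i in
  [/\ 0 <=v w, w <=v z & forall a, a \in s -> disjoint w a].
Proof.
elim: s z => [|a s IH] z sa z0.
  exists (fun=> 0); rewrite big_ord0 subr0; split=> //; exact: lev_refl.
have [c0 [w0 wz wa]] := atom_split (sa a (mem_head _ _)) z0.
have [|c [v0 vw vs]] := IH _ _ w0; first by move=> b bs; apply: sa; rewrite inE bs orbT.
exists (fun i => if i is i'.+1 then c i' else c0); rewrite big_ord_recl /= opprD addrA.
split=> //; first exact: lev_trans vw wz.
move=> b; rewrite inE => /predU1P[->|]; last exact: vs.
by apply: disjoint_le wa => //; exact: lev_refl.
Qed.

(** What is left of a positive z after subtracting multiples of the atoms is
    disjoint from all of them, hence zero. *)
Lemma finite_atoms (s : seq V) : (forall a, a \in s -> atom a) ->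
  (forall z, 0 <=v z -> (forall a, a \in s -> disjoint z a) -> z = 0) ->
  finite_rank (@idfun V).
Proof.
move=> sa smax; exists (size s), (fun i => nth 0 s i) => x.
have span z : 0 <=v z -> exists c : nat -> R, z = \sum_(i < size s) c i *: nth 0 s i.
  move=> z0; have [c [w0 _ ws]] := atoms_split sa z0.
  exists c; apply/eqP; rewrite -subr_eq0; apply/eqP; exact: smax.
have [c ec] := span _ (posv_ge0 x); have [d ed] := span _ (posv_ge0 (- x)).
exists (fun i : 'I__ => c i - d i); rewrite /= -[LHS]posvBN ec ed -sumrB.
by apply: eq_bigr => i _; rewrite scalerBl.
Qed.

Definition disjoint_seq (d : nat -> V) :=
  (forall n, 0 <=v d n /\ d n <> 0) /\ forall i j, i != j -> disjoint (d i) (d j).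

Lemma disjoint_seq_lt (d : nat -> V) : (forall n, 0 <=v d n /\ d n <> 0) ->
  (forall i j, (i < j)%N -> disjoint (d i) (d j)) -> disjoint_seq d.
Proof.
move=> d0 H; split=> // i j; rewrite neq_ltn => /orP[/H//|/H].
exact: disjointC.
Qed.

(** Below an element with no atom underneath, one can keep splitting: each element
    contains two disjoint ones, of which the first is recorded and the second is
    split further. *)
Lemma atom_below z : (forall d, ~ disjoint_seq d) -> 0 <=v z -> z <> 0 ->
  exists2 a, atom a & a <=v z.
Proof.
move=> nod z0 zn; apply: contrapT => noa.
pose U := {u : V | [/\ 0 <=v u, u <> 0 & u <=v z]}.
have step (u : U) : exists pq : U * U,
    [/\ sval pq.1 <=v sval u, sval pq.2 <=v sval u & disjoint (sval pq.1) (sval pq.2)].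
  case: u => u [u0 un uz] /=; apply: contrapT => H; apply: noa; exists u => //.
  split=> // p q p0 q0 pu qu pq; apply: contrapT => /not_orP[pn qn]; apply: H.
  by exists (exist _ p (And3 p0 pn (lev_trans pu uz)), exist _ q (And3 q0 qn (lev_trans qu uz))).
have [pq pqP] := choice step.
pose u := fix u n : U := if n is n'.+1 then (pq (u n')).2 else exist _ z (And3 z0 zn (lev_refl z)).
have umono i j : (i <= j)%N -> sval (u j) <=v sval (u i).
  move=> /subnK <-; elim: (j - i)%N => [|k IH]; first exact: lev_refl.
  by rewrite addSn /=; apply: lev_trans IH; have [] := pqP (u (k + i)%N).
apply: (nod (fun n => sval (pq (u n)).1)); apply: disjoint_seq_lt => [n|i j ij].
  by have [] := svalP (pq (u n)).1.
have [_ _ ] := pqP (u i); apply: disjoint_le; first exact: lev_refl.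
have [h _ _] := pqP (u j); apply: lev_trans h _; exact: umono ij.
Qed.

(** Without disjoint sequences there are atoms below every element, so atoms can
    be chosen one after the other, each disjoint from the previous ones, for as
    long as they do not span. *)
Lemma exists_disjoint_seq : infinite_dimensional V -> exists d, disjoint_seq d.
Proof.
move=> infV; apply: contrapT => /forallNP nod.
pose L := {s : seq V | forall a, a \in s -> atom a}.
have step (s : L) : exists a, atom a /\ forall b, b \in sval s -> disjoint a b.
  case: s => s sa /=; apply: contrapT => H; apply: infV.
  apply: (finite_atoms sa) => z z0 zs; apply: contrapT => zn.
  have [a aa az] := atom_below nod z0 zn; apply: H; exists a; split=> // b bs.
  by apply: disjoint_le (zs b bs) => //; exact: lev_refl.
have [g gP] := choice step.
have consP (s : L) a : a \in g s :: sval s -> atom a.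
  rewrite inE => /predU1P[->|]; first by have [] := gP s.
  by have := svalP s; apply.
have nilP a : a \in [::] -> atom a by [].
pose l := fix l n : L := if n is n'.+1 then exist _ _ (@consP (l n')) else exist _ _ nilP.
have lP i j : (i < j)%N -> g (l i) \in sval (l j).
  elim: j => // j IH; rewrite ltnS leq_eqVlt => /predU1P[->|/IH] /=.
    by rewrite mem_head.
  by rewrite inE => ->; rewrite orbT.
apply: (nod (fun n => g (l n))); apply: disjoint_seq_lt => [n|i j ij].
  by have [[]] := gP (l n).
by apply: disjointC; have [_] := gP (l j); apply; exact: lP.
Qed.

Lemma exists_normalized_disjoint_seq : infinite_dimensional V ->
  exists d, disjoint_seq d /\ forall n, `|d n| = 1.
Proof.
move=> /exists_disjoint_seq[d [d0 dd]].
have nd n : `|d n| != 0 by rewrite normr_eq0; apply/eqP; have [] := d0 n.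
exists (fun n => `|d n|^-1 *: d n); split; last first.
  by move=> n; rewrite normrZ normfV normr_id mulVf.
split=> [n|i j ij].
  have [dn0 dn] := d0 n; split; first by apply: scalev_ge0; rewrite ?invr_ge0.
  by move=> /eqP; rewrite scaler_eq0 invr_eq0 (negbTE (nd n)) => /eqP.
have sc k u : disjoint (d k) u -> disjoint (`|d k|^-1 *: d k) u.
  by apply: disjointZ; [rewrite invr_ge0|have [] := d0 k].
by apply/sc/disjointC/sc/disjointC/dd.
Qed.

End disjointness.

(** * Families of functionals with small signed sums *)
Section dual_infinite_dimensional.
Variables (R : realType) (F : banachLatticeType R).

(** If n functionals spanned the dual, a nontrivial combination of n + 1 disjoint
    vectors would be killed by all of them, hence would vanish, although disjoint
    vectors are linearly independent. *)
Lemma dual_infinite_dimensional :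
  infinite_dimensional F -> infinite_dimensional (dual F).
Proof.
move=> /exists_disjoint_seq[d [d0 dd]] [n [e espan]].
pose A : 'M[R]_(n.+1, n) := \matrix_(j, i) e i (d j).
have kA : kermx A != 0.
  rewrite -mxrank_eq0 mxrank_ker -lt0n subn_gt0 ltnS.
  exact: rank_leq_col.
have [i ri] : exists i, row i (kermx A) != 0.
  by apply/existsP; rewrite -negb_forall; apply: contra kA => /forallP/= H; apply/eqP/row_matrixP => i; rewrite row0; apply/eqP.
set c := row i (kermx A) in ri.
have cA : c *m A = 0 by apply/sub_kermxP; exact: row_sub.
pose x := \sum_(j < n.+1) c 0 j *: d j.
have ex k : e k x = 0.
  have /matrixP/(_ 0 k) := cA; rewrite mxE [RHS]mxE => <-.
  by rewrite linear_sum; apply: eq_bigr => j _; rewrite linearZ [A j k]mxE.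
have gx (g : dual F) : g x = 0.
  have [a /= ->] := espan g; elim/big_rec: _ => //= k h _ hx.
  by rewrite -[LHS]/(a k *: e k x + h x) ex hx scaler0 addr0.
have x0 : x = 0 by apply: lev_anti; apply: lev_dual => g _ _; rewrite gx linear0.
have := @disjoint_abs_sum _ _ _ (fun j : 'I_n.+1 => d j) (fun j => c 0 j)
  (fun j => (d0 j).1) (fun j k jk => dd _ _ jk).
rewrite -/x x0 absv_id; last exact: lev_refl.
move=> s0; move: ri; apply/negP; rewrite negbK; apply/eqP/rowP => j; rewrite [RHS]mxE.
have : `|c 0 j| *: d j = 0.
  apply: lev_anti; last by apply: scalev_ge0 => //; exact: (d0 j).1.
  apply: lev_trans s0; rewrite (bigD1 j)//= -[X in X <=v _]addr0.
  apply: lev_add; first exact: lev_refl.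
  by apply: sumv_ge0 => k _; apply: scalev_ge0 => //; exact: (d0 k).1.
move/eqP; rewrite scaler_eq0 normr_eq0 => /orP[/eqP//|/eqP dj].
by have [] := d0 j.
Qed.

End dual_infinite_dimensional.

Section rademacher.
Variables (R : realType) (n : nat).
Implicit Types (s : {ffun 'I_n -> bool}) (t : 'I_n -> R).

(** The Rademacher functions on the cube of signs. *)
Definition rad (k : 'I_n) s : R := (-1) ^+ s k.

Lemma rad_norm k s : `|rad k s| = 1.
Proof. by rewrite /rad normrX normrN1 expr1n. Qed.

(** Flipping the k-th sign reverses the sign of the sum. *)
Lemma rad_orthogonal k l : k != l -> \sum_s rad k s * rad l s = 0.
Proof.
move=> kl; pose flip s := [ffun i => (i == k) (+) s i].
have flipK : involutive flip by move=> s; apply/ffunP => i; rewrite !ffunE addKb.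
have : \sum_s rad k s * rad l s = - \sum_s rad k s * rad l s.
  rewrite [LHS](reindex_inj (inv_inj flipK)) -sumrN; apply: eq_bigr => s _.
  rewrite /rad !ffunE eqxx eq_sym (negbTE kl) /= -mulNr; congr (_ * _).
  by case: (s k); rewrite ?expr0 ?expr1 ?opprK.
by move=> h; lra.
Qed.

Lemma rad_second_moment t :
  \sum_s (\sum_k t k * rad k s) ^+ 2 = \sum_(s : {ffun 'I_n -> bool}) \sum_k t k ^+ 2.
Proof.
under eq_bigr do rewrite expr2 big_distrlr /=.
rewrite exchange_big [RHS]exchange_big; apply: eq_bigr => k _ /=.
rewrite exchange_big (bigD1 k)//= [X in _ + X]big1 ?addr0 => [|l lk].
  apply: eq_bigr => s _; rewrite mulrACA -!expr2.
  by rewrite -[rad k s ^+ 2]real_normK ?num_real// rad_norm expr1n mulr1.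
under eq_bigr do rewrite mulrACA.
by rewrite -mulr_sumr rad_orthogonal ?mulr0// eq_sym.
Qed.

End rademacher.

(** With n = i^2 functions, |u| <= (u^2 / i + i) / 2 reduces the first moment to
    the second one and gives the square root of n, instead of n, as mean value. *)
Lemma rad_first_moment (R : realType) (j : nat) (t : 'I_(j.+1 ^ 2) -> R) :
  (forall k, `|t k| <= 1) ->
  \sum_s `|\sum_k t k * rad R k s| <= #|{: {ffun 'I_(j.+1 ^ 2) -> bool}}|%:R * j.+1%:R.
Proof.
move=> t1; set i : R := j.+1%:R; have i0 : 0 < i by rewrite ltr0n.
have am (u : R) : `|u| <= 2^-1 * (u ^+ 2 / i + i).
  rewrite -real_normK ?num_real//; set v := `|u|.
  rewrite ler_pdivlMl// -(ler_pM2r i0) [leRHS]mulrDl mulfVK ?gt_eqF//.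
  by have := sqr_ge0 (v - i); lra.
apply: (@le_trans _ _ (\sum_(s : {ffun 'I_(j.+1 ^ 2) -> bool})
    2^-1 * ((\sum_k t k * rad R k s) ^+ 2 / i + i))).
  by apply: ler_sum => s _; exact: am.
rewrite -mulr_sumr big_split /= -mulr_suml rad_second_moment mulr_suml -big_split /=.
rewrite mulr_natl -sumr_const mulr_sumr; apply: ler_sum => s _.
have : \sum_k t k ^+ 2 <= i ^+ 2.
  rewrite -natrX -[X in _ <= X%:R]card_ord -sumr_const; apply: ler_sum => k _.
  by rewrite -real_normK ?num_real// expr_le1.
rewrite -(ler_pdivrMr _ _ i0); move: (_ / i) => q; lra.
Qed.

(** Termwise, the modulus of t_j h_j is at most h_j. *)
Lemma norm_multiplier_sum_le (R : realType) (V : banachLatticeType R) m (t : nat -> R) (h : nat -> V) :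
  (forall j, `|t j| <= 1) -> (forall j, 0 <=v h j) ->
  `|\sum_(j < m) t j *: h j| <= `|\sum_(j < m) h j|.
Proof.
move=> t1 h0; apply: lattice_norm; apply: lev_trans (absv_ge _).
elim/big_ind2: _ => [|x1 x2 y1 y2 h1 h2|i _].
- by rewrite absv_id; exact: lev_refl.
- by apply: lev_trans (absvD _ _) _; exact: lev_add.
- rewrite absvZ absv_id//; apply: (lev_subr _ _).2.
  rewrite -[X in _ <=v X - _]scale1r -scalerBl.
  by apply: scalev_ge0; rewrite ?subr_ge0.
Qed.

Section spread_families.
Variables (R : realType) (F : banachLatticeType R).

Lemma almost_norming (g : dual F) : exists y : F, `|y| <= 1 /\ `|g| / 2 <= g y.
Proof.
apply: contrapT => H.
have small (y : F) : `|y| <= 1 -> g y < `|g| / 2.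
  by move=> y1; rewrite ltNge; apply/negP => gy; apply: H; exists y.
have small' (y : F) : `|y| <= 1 -> `|g y| <= `|g| / 2.
  move=> y1; rewrite ler_norml lerNl -linearN.
  by rewrite (ltW (small _ y1)) andbT ltW// small// normrN.
have : `|g| <= `|g| / 2.
  apply: bop_norm_le => [|x]; first by rewrite divr_ge0.
  have [->|x0] := eqVneq x 0; first by rewrite linear0 !normr0 mulr0.
  have nx : 0 < `|x| by rewrite normr_gt0.
  rewrite -ler_pdivrMr// -[X in _ / X](ger0_norm (normr_ge0 x)) -normfV mulrC -normrM.
  rewrite -[_ * _]/(`|x|^-1 *: g x) -linearZ; apply: small'.
  by rewrite normrZ normfV normr_id mulVf// gt_eqF.
have := small 0; rewrite normr0 linear0 ler01 => /(_ isT); lra.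
Qed.

(** The g_j have total mass of order one, as witnessed by the y_j, but all their
    sums with multipliers are small. A single weak-star null normalized sequence
    would do the same work with m = 1, at the price of a deeper theorem. *)
Definition spread_family (eps : R) (m : nat) (g : nat -> dual F) (y : nat -> F) :=
  [/\ forall j, `|y j| <= 1,
      \sum_(j < m) g j (y j) = 1,
      \sum_(j < m) `|g j| <= 2 &
      forall t : nat -> R, (forall j, `|t j| <= 1) ->
        `|\sum_(j < m) t j *: g j| <= eps].

(** Normalization: only the ratio of the sum of the norms to the size M of the
    signed sums matters. The y_j are positive if the g_j are, because a positive
    functional is larger at |y| than at y. *)
Lemma spread_of_sums (m : nat) (g : nat -> dual F) (M C : R) : 0 < C ->
  (forall t : nat -> R, (forall j, `|t j| <= 1) -> `|\sum_(j < m) t j *: g j| <= M) ->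
  C * M < \sum_(j < m) `|g j| ->
  exists s (y : nat -> F), [/\ 0 < s,
    (forall j, positive (g j)) -> forall j, 0 <=v y j &
    spread_family (2 / C) m (fun j => s *: g j) y].
Proof.
move=> C0 tM CM.
have [y /all_and2[y1 gy]] := choice (fun j => almost_norming (g j)).
have [z [z1 gz z0]] : exists z : nat -> F, [/\ forall j, `|z j| <= 1,
    forall j, `|g j| / 2 <= g j (z j) &
    (forall j, positive (g j)) -> forall j, 0 <=v z j].
  have [pg|npg] := pselect (forall j, positive (g j)); last by exists y.
  exists (fun j => absv (y j)); split=> [j|j|_ j]; last exact: absv_ge0.
    by rewrite norm_absv.
  by apply: le_trans (gy j) _; apply: positive_mono => //; exact: absv_ge.
have M0 : 0 <= M by apply: le_trans (tM (fun=> 0) _) => // j; rewrite normr0.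
pose S := \sum_(j < m) g j (z j).
have Sg : (\sum_(j < m) `|g j|) / 2 <= S.
  by rewrite mulr_suml; apply: ler_sum => j _; exact: gz.
have S0 : 0 < S.
  apply: lt_le_trans Sg; rewrite divr_gt0//; apply: le_lt_trans CM.
  by rewrite mulr_ge0// ltW.
have CMS : C * M <= 2 * S.
  by move: Sg CM; move: (C * M) (\sum_(j < m) `|g j|) S S0 => a b c; lra.
exists S^-1, z; split; rewrite ?invr_gt0//; split=> //.
- under eq_bigr do rewrite bopZ.
  by rewrite -scaler_sumr -[LHS]/(S^-1 * S) mulVf// gt_eqF.
- under eq_bigr do rewrite normrZ gtr0_norm ?invr_gt0//.
  by rewrite -mulr_sumr ler_pdivrMl// -ler_pdivrMr.
- move=> t t1; under eq_bigr do rewrite scalerA mulrC -scalerA.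
  rewrite -scaler_sumr normrZ gtr0_norm ?invr_gt0// ler_pdivrMl//.
  rewrite [X in _ <= X]mulrA ler_pdivlMr// [S * 2]mulrC [leLHS]mulrC.
  by apply: le_trans CMS; rewrite ler_pM2l// tM.
Qed.

(** Suppose that in the dual the sum of the norms is always controlled by C times
    the signed sums. Then N disjoint normalized functionals span a copy of the N
    dimensional l1 space, in which the Rademacher vectors g_k = sum_s r_k(s) h_s
    contradict the assumption: each has norm at least N / C, but the signed sums of
    n of them are at most N times the square root of n. *)
Lemma exists_spread_family (eps : R) : infinite_dimensional F -> 0 < eps ->
  exists m g y, spread_family eps m g y.
Proof.
move=> infF eps0; apply: contrapT => H; pose C := 2 / eps.
have C0 : 0 < C by rewrite divr_gt0.
have CE : 2 / C = eps by rewrite /C invf_div mulrC divfK ?pnatr_eq0.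
have H1 m (g : nat -> dual F) M :
    (forall t : nat -> R, (forall j, `|t j| <= 1) -> `|\sum_(j < m) t j *: g j| <= M) ->
    \sum_(j < m) `|g j| <= C * M.
  move=> gM; rewrite leNgt; apply/negP => /(spread_of_sums C0 gM)[s [y [_ _ sy]]].
  by apply: H; exists m, (fun j => s *: g j), y; rewrite -CE.
have [d [[d0 dd] d1]] := exists_normalized_disjoint_seq (dual_infinite_dimensional infF).
pose j := Num.truncn (C ^+ 2).
(* With i = j.+1 the estimates below for i^2 Rademacher vectors give i <= C^2. *)
have Cj : C ^+ 2 < j.+1%:R by exact: truncnS_gt.
pose X : finType := {ffun 'I_(j.+1 ^ 2) -> bool}.
pose h (s : X) := d (enum_rank s).
have X0 : 0 < #|X|%:R :> R.
  by rewrite ltr0n; apply/card_gt0P; exists [ffun=> true].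
have h0 s : 0 <=v h s by have [] := d0 (enum_rank s).
have hd (s t : X) : s != t -> disjoint (h s) (h t).
  by move=> st; apply: dd; rewrite (inj_eq val_inj) (inj_eq enum_rank_inj).
(* The hypothesis applied to the disjoint functionals themselves. *)
have N1 : #|X|%:R <= C * `|\sum_s h s|.
  have -> : \sum_s h s = \sum_(i < #|X|) d i.
    by rewrite (reindex enum_rank) //=; exists enum_val => i _; [exact: enum_rankK|exact: enum_valK].
  have -> : #|X|%:R = \sum_(i < #|X|) `|d i|.
    by under eq_bigr do rewrite d1; rewrite sumr_const card_ord.
  apply: H1 => t t1; apply: norm_multiplier_sum_le => // i.
  by have [] := d0 i.
pose g (k : nat) : dual F := \sum_s (if insub k is Some k' then rad R k' s else 0) *: h s.
have gk (k : 'I_(j.+1 ^ 2)) : g k = \sum_s rad R k s *: h s by rewrite /g valK.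
(* By disjointness |g k| is the sum of all h s, whatever k is. *)
have ng (k : 'I_(j.+1 ^ 2)) : `|\sum_s h s| <= `|g k|.
  apply: lattice_norm; rewrite absv_id; last by apply: sumv_ge0 => s _; exact: h0.
  rewrite gk; apply: lev_trans (disjoint_abs_sum _ h0 hd).
  by under [X in _ <=v X]eq_bigr do rewrite rad_norm scale1r; exact: lev_refl.
have gM (t : nat -> R) : (forall k, `|t k| <= 1) ->
    `|\sum_(k < j.+1 ^ 2) t k *: g k| <= #|X|%:R * j.+1%:R.
  move=> t1; have -> : \sum_(k < j.+1 ^ 2) t k *: g k =
      \sum_s (\sum_(k < j.+1 ^ 2) t k * rad R k s) *: h s.
    under eq_bigr do rewrite gk scaler_sumr.
    rewrite exchange_big; apply: eq_bigr => s _; rewrite scaler_suml.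
    by apply: eq_bigr => k _; rewrite scalerA.
  apply: le_trans (ler_norm_sum _ _ _) _.
  apply: le_trans (rad_first_moment (t := fun k => t k) (fun k => t1 k)).
  by apply: ler_sum => s _; rewrite normrZ d1 mulr1.
have := H1 _ _ _ gM; apply/negP; rewrite -ltNge.
have j0 : 0 < j.+1%:R :> R by rewrite ltr0n.
apply: (@lt_le_trans _ _ (\sum_(k < j.+1 ^ 2) (#|X|%:R / C))); last first.
  apply: ler_sum => k _; apply: le_trans (ng k).
  by rewrite ler_pdivrMr// mulrC.
rewrite sumr_const card_ord -[ltRHS]mulr_natl natrX mulrCA [ltRHS]mulrCA ltr_pM2l//.
rewrite ltr_pdivlMr// mulrAC expr2 ltr_pM2r//.
Qed.

End spread_families.

(** * Positive families on reflexive lattices *)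
Section bidual.
Variables (R : realType) (X : normedModType R).

Let eval_bop (x : X) : (fun f : dual X => f x) \in @bop_pred R (dual X) R^o.
Proof.
apply: (@bop_bound _ _ _ _ `|x|) => [a f g //|f].
by rewrite mulrC; exact: (opnormP f x).
Qed.

Definition bidual_eval (x : X) : dual (dual X) := Bop (eval_bop x).

Lemma norm_bidual_eval x : `|bidual_eval x| <= `|x|.
Proof. by apply: bop_norm_le => // f; rewrite mulrC; exact: (opnormP f x). Qed.

End bidual.

Section reflexive_spread_families.
Variables (R : realType) (F : banachLatticeType R).

(** The partial sums s_n of y increase below x, so they have a weak limit z. By
    [cone_separation] there is a functional that is at least 1 at all z - s_n,
    because z - s_n decreases and dominates y_n: this contradicts weak
    convergence. *)
Lemma reflexive_bounded_disjoint (x : F) (y : nat -> F) : reflexive_space F ->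
  disjoint_seq y -> (forall n, y n <=v x) -> (forall n, 1 <= `|y n|) -> False.
Proof.
move=> reflF [y0 yd] yx y1.
have y0' n : 0 <=v y n by have [] := y0 n.
pose s n := \sum_(i < n) y i.
have s0 n : 0 <=v s n by apply: sumv_ge0 => i _.
have sS n : s n.+1 = s n + y n by rewrite /s big_ord_recr.
have smono i j : (i <= j)%N -> s i <=v s j.
  move=> /subnK <-; elim: (j - i)%N => [|k IH]; first exact: lev_refl.
  rewrite addSn sS; apply: lev_trans IH _.
  by rewrite -[X in X <=v _]addr0; apply: lev_add => //; exact: lev_refl.
have x0 : 0 <=v x by exact: lev_trans (yx 0%N).
have sx n : s n <=v x.
  elim: n => [|n IH]; first by rewrite /s big_ord0.
  rewrite sS; apply: disjoint_addv_le => //.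
  by apply: disjoint_sum => // i _; apply: yd; rewrite neq_ltn ltn_ord.
have [|psi _ psiP] := @dual_limit _ _ (fun n => bidual_eval (s n)) `|x|.
  by move=> n; apply: le_trans (norm_bidual_eval _) _; exact: normv_le.
have [z psiz] := reflF psi.
have sz n : s n <=v z.
  apply: lev_dual => g pg _; rewrite -psiz; apply: psiP.
  by exists n => // k /= nk; apply: positive_mono => //; exact: smono.
pose D : set (F * R) := [set d | exists n, 0 <= d.2 /\ d.2 *: (z - s n) <=v d.1].
have [|[d r] [n /= [r0 rd]]|g _ gD] := @cone_separation _ _ D 1 ler01.
- split=> [|[u a] [v b] [i /= [a0 au]] [j /= [b0 bv]]|c [u a] c0 [i /= [a0 au]]].
  + by exists 0%N; rewrite /= scale0r; split=> //; exact: lev_refl.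
  + exists (maxn i j); rewrite /= addr_ge0//; split=> //; rewrite scalerDl.
    apply: lev_add; [apply: lev_trans au|apply: lev_trans bv];
      apply: lev_scale => //; apply: lev_add; try exact: lev_refl;
      apply/lev_opp/smono; [exact: leq_maxl|exact: leq_maxr].
  + exists i; rewrite /= mulr_ge0// ?ltW//; split=> //.
    by rewrite -scalerA; apply: lev_scale => //; exact: ltW.
- rewrite mul1r; have := normv_le (scalev_ge0 r0 ((lev_subr _ _).1 (sz n))) rd.
  apply: le_trans; rewrite normrZ ger0_norm// -[leLHS]mulr1 ler_wpM2l//.
  apply: le_trans (y1 n) _; apply: normv_le => //.
  by have := lev_add2r (- s n) (sz n.+1); rewrite sS addrC addKr.
have gs n : g (s n) <= g z - 1.
  have : 1 <= g (z - s n) by apply: (gD (z - s n, 1)); exists n; rewrite /= scale1r; split=> //; exact: lev_refl.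
  by rewrite linearB /= => h; lra.
have : 1 - g z <= psi (- g).
  apply: psiP; exists 0%N => // n _ /=; rewrite -[leRHS]/(- g (s n)).
  by have := gs n; lra.
by rewrite psiz bopN; lra.
Qed.

(** Otherwise the dual of F is an abstract L-space up to a constant: sums of
    norms of positive functionals are controlled by the norm of the sum. By
    [cone_separation] there is then an element x of the bidual, that is of F,
    with |g| <= g x for all positive g. All positive vectors of norm one lie
    below x, which contradicts [reflexive_bounded_disjoint] for a normalized
    disjoint sequence of F. *)
Lemma exists_positive_spread_family (eps : R) :
  infinite_dimensional F -> reflexive_space F -> 0 < eps ->
  exists m (g : nat -> dual F) (y : nat -> F),
    [/\ spread_family eps m g y, forall j, positive (g j) & forall j, 0 <=v y j].
Proof.
move=> infF reflF eps0; apply: contrapT => H; pose C := 2 / eps.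
have C0 : 0 < C by rewrite divr_gt0.
have CE : 2 / C = eps by rewrite /C invf_div mulrC divfK ?pnatr_eq0.
have H1 m (g : nat -> dual F) : (forall j, positive (g j)) ->
    \sum_(j < m) `|g j| <= C * `|\sum_(j < m) g j|.
  move=> pg; rewrite leNgt; apply/negP => /(spread_of_sums C0)[].
    by move=> t t1; apply: norm_multiplier_sum_le => // j; apply/bop_ge0P.
  move=> s [y [s0 /(_ pg) y0 sy]].
  apply: H; exists m, (fun j => s *: g j), y; split=> //; first by rewrite -CE.
  by move=> j x x0; rewrite bopZ; apply: (scalev_ge0 (ltW s0)); exact: pg.
pose D : set (dual F * R) := [set d | exists s : seq (dual F),
  (forall g, g \in s -> positive g) /\ d = (\sum_(g <- s) g, \sum_(g <- s) `|g|)].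
have [|d [s [ps ->]] /=|rho _ rhoD] := @cone_separation _ _ D C (ltW C0).
- split=> [|_ _ [s [ps ->]] [t [pt ->]]|c _ c0 [s [ps ->]]].
  + by exists [::]; rewrite !big_nil.
  + exists (s ++ t); rewrite !big_cat; split=> // g.
    by rewrite mem_cat => /orP[/ps|/pt].
  + exists [seq c *: g | g <- s]; rewrite !big_map /= scaler_sumr mulr_sumr; split.
      by move=> _ /mapP[g /ps pg ->] x x0; rewrite bopZ; apply: (scalev_ge0 (ltW c0)); exact: pg.
    by congr (_, _); apply: eq_bigr => g _; rewrite normrZ gtr0_norm.
- rewrite 2!(big_nth (0 : dual F)) 2!big_mkord; apply: H1 => j.
  have [js|js] := ltnP j (size s); first exact/ps/mem_nth.
  by rewrite nth_default// => x _; exact: lev_refl.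
have [x rhox] := reflF rho.
have [y [[y0 yd] y1]] := exists_normalized_disjoint_seq infF.
apply: (reflexive_bounded_disjoint reflF (conj y0 yd) (x := x)) => n; last by rewrite y1.
apply: lev_dual => g pg _; rewrite -rhox.
apply: (@le_trans _ _ `|g|).
  by apply: le_trans (ler_norm _) _; apply: le_trans (opnormP _ _) _; rewrite y1 mulr1.
apply: (rhoD (g, `|g|)); exists [:: g]; rewrite !big_seq1; split=> // h.
by rewrite inE => /eqP ->.
Qed.

End reflexive_spread_families.

(** * Averages over signs *)
Section sign_average.
Variables (R : realType) (E : banachLatticeType R).
Implicit Types (xs ys : seq E) (u v w x : E) (f : dual E).

(** The average of |v + sum_i eps_i x_i| over all signs eps. It stands in for the
    square function of the x_i: it increases with the list, and its norm is
    bounded by that of the signed sums. *)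
Fixpoint sign_avg xs v : E :=
  if xs is x :: xs' then 2^-1 *: (sign_avg xs' (v + x) + sign_avg xs' (v - x))
  else absv v.

Let half_double u : (2^-1 : R) *: (u + u) = u.
Proof. by rewrite scalerDr -scalerDl -[2^-1]div1r -splitr scale1r. Qed.

Let half_ge0 : (0 : R) <= 2^-1. Proof. by rewrite invr_ge0. Qed.

Lemma sign_avg_lip xs v w : sign_avg xs (v + w) <=v sign_avg xs v + absv w.
Proof.
elim: xs v => [|x xs IH] v /=; first exact: absvD.
rewrite -[absv w in X in _ <=v X]half_double -scalerDr; apply: lev_scale => //.
by rewrite addrACA; apply: lev_add; rewrite addrAC; exact: IH.
Qed.

Lemma sign_avg_cons_le xs x v : sign_avg (x :: xs) v <=v sign_avg xs v + absv x.
Proof.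
rewrite /= -[X in _ <=v X]half_double; apply: lev_scale => //.
by apply: lev_add; [|rewrite -(absvN x)]; exact: sign_avg_lip.
Qed.

(** The average is convex in v. *)
Lemma sign_avg_cons_ge xs x v : sign_avg xs v <=v sign_avg (x :: xs) v.
Proof.
rewrite -[X in X <=v _]half_double; apply: lev_scale => //.
elim: xs x v => [|y xs IH] x v /=.
  have -> : absv v + absv v = absv (v + v).
    by rewrite -mulr2n -[in RHS]mulr2n -scaler_nat -[v *+ 2]scaler_nat absvZ ger0_norm.
  by apply: lev_trans (absvD _ _); rewrite addrACA subrr addr0; exact: lev_refl.
rewrite -!scalerDr; apply: lev_scale => //.
rewrite addrACA [X in _ <=v X]addrACA.
rewrite (addrAC v x y) (addrAC v (- x) y) (addrAC v x (- y)) (addrAC v (- x) (- y)).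
by apply: lev_add; exact: IH.
Qed.

Lemma sign_avg_ge_absv xs v : absv v <=v sign_avg xs v.
Proof.
elim: xs => [|x xs IH]; first exact: lev_refl.
exact: lev_trans IH (sign_avg_cons_ge _ _ _).
Qed.

Lemma sign_avg_ge_head x xs : absv x <=v sign_avg (x :: xs) 0.
Proof.
rewrite -[X in X <=v _]half_double /= add0r sub0r; apply: lev_scale => //.
by apply: lev_add; [|rewrite -absvN]; exact: sign_avg_ge_absv.
Qed.

Lemma sign_avg_le_sum xs : sign_avg xs 0 <=v \sum_(x <- xs) absv x.
Proof.
elim: xs => [|x xs IH]; first by rewrite big_nil /= absv_id; exact: lev_refl.
rewrite big_cons addrC; apply: lev_trans (sign_avg_cons_le _ _ _) _.
exact: lev_add2r.
Qed.

Lemma sign_avg_swap xs ys x v : sign_avg (xs ++ x :: ys) v = sign_avg (x :: xs ++ ys) v.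
Proof.
elim: xs v => //= y xs IH v; rewrite !IH /= -!scalerDr.
rewrite addrACA (addrAC v y x) (addrAC v y (- x)).
by rewrite (addrAC v (- y) x) (addrAC v (- y) (- x)).
Qed.

Lemma sign_avg_opp xs ys x v : sign_avg (xs ++ - x :: ys) v = sign_avg (xs ++ x :: ys) v.
Proof. by rewrite !sign_avg_swap /= opprK addrC. Qed.

(** The Riesz product proof of Khinchin's inequality. Starting from the complex
    number p + i q, each sign eps multiplies it by c + i eps s, of modulus one.
    The imaginary part of the product is a weight in [-1, 1] for each choice of
    signs, so the average of weight times signed sum, computed on the left, is
    below the average of absolute values. *)
Lemma riesz_product f xs v (c s p q : R) : positive f -> 0 <= c ->
  c ^+ 2 + s ^+ 2 = 1 -> p ^+ 2 + q ^+ 2 <= 1 ->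
  q * c ^+ (size xs).+1 * f v + p * s * c ^+ (size xs) * (\sum_(x <- xs) f x) <=
  c * f (sign_avg xs v).
Proof.
move=> pf c0 cs1; elim: xs v p q => [|x xs IH] v p q pq1.
  rewrite big_nil mulr0 addr0 /= expr1 [q * c]mulrC -mulrA ler_wpM2l//.
  have q1 : `|q| <= 1.
    rewrite -(@expr_le1 _ 2 `|q|)// real_normK ?num_real//.
    by have := sqr_ge0 p; lra.
  apply: le_trans (ler_norm _) _; rewrite normrM.
  by apply: le_trans (ler_piMl _ q1) _ => //; exact: positive_abs.
rewrite big_cons /= linearZ linearD /= -[_ *: _]/(2^-1 * _).
have rot (a : R) : a ^+ 2 = 1 ->
    (p * c - a * (q * s)) ^+ 2 + (q * c + a * (p * s)) ^+ 2 <= 1.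
  move=> a2; rewrite (_ : _ + _ = (p ^+ 2 + q ^+ 2) * (c ^+ 2 + a ^+ 2 * s ^+ 2)); last by ring.
  by rewrite a2 mul1r cs1 mulr1.
have h1 := IH (v + x) _ _ (rot 1 (expr1n _ _)).
have h2 := IH (v - x) _ _ (rot (-1) (sqrr_sign _ 1)).
rewrite linearD /= in h1; rewrite linearB /= in h2.
move: (f v : R) (f x : R) (f (sign_avg xs (v + x)) : R) (f (sign_avg xs (v - x)) : R)
  (\sum_(x <- xs) f x : R) h1 h2 => a b X Y S.
rewrite /= !exprS; move: (c ^+ size xs) => C h1 h2 /=.
suff : 2 * (q * (c * (c * C)) * a + p * s * (c * C) * (b + S)) <= c * X + c * Y by lra.
apply: le_trans (lerD h1 h2); rewrite le_eqVlt; apply/orP; left; apply/eqP.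
ring.
Qed.

Lemma sum_le_sign_avg xs (c s : R) : 0 <= c -> c <= 1 -> 0 <= s ->
  c ^+ 2 + s ^+ 2 = 1 ->
  (s * c ^+ size xs) *: (\sum_(x <- xs) x) <=v sign_avg xs 0.
Proof.
move=> c0 c1 s0 cs1; apply: lev_dual => f pf _.
have := @riesz_product f xs 0 c s 1 0 pf c0 cs1.
rewrite expr1n expr0n addr0 lexx => /(_ isT); rewrite !mul0r add0r mul1r.
rewrite linearZ linear_sum => h; apply: le_trans h _.
rewrite -[leRHS]mul1r; apply: ler_wpM2r => //; apply: positive_ge0 => //.
by apply: lev_trans (sign_avg_ge_absv _ _); exact: absv_ge0.
Qed.

Lemma scale_joinv_le (t : R) u v w : 0 <= t ->
  t *: u <=v w -> t *: v <=v w -> t *: joinv u v <=v w.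
Proof.
rewrite le_eqVlt => /predU1P[<-|t0]; first by rewrite !scale0r.
have ti : 0 <= t^-1 by rewrite invr_ge0 ltW.
move=> /(lev_scale ti) + /(lev_scale ti).
rewrite !scalerA mulVf ?gt_eqF// !scale1r => uw vw.
have := lev_scale (ltW t0) (joinv_le uw vw).
by rewrite scalerA mulfV ?gt_eqF// scale1r.
Qed.

(** The previous bound holds for all choices of signs in front of the x_i, because
    the average does not see them, and the sum of the |x_i| is the supremum of
    these signed sums. The induction moves the x_i one by one from the part with
    absolute values to the part with signs. *)
Lemma sum_abs_le_sign_avg xs (c s : R) : 0 <= c -> c <= 1 -> 0 <= s ->
  c ^+ 2 + s ^+ 2 = 1 ->
  (s * c ^+ size xs) *: (\sum_(x <- xs) absv x) <=v sign_avg xs 0.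
Proof.
move=> c0 c1 s0 cs1; set t := _ * _.
have t0 : 0 <= t by rewrite mulr_ge0 ?exprn_ge0.
have base ys : size ys = size xs -> t *: (\sum_(x <- ys) x) <=v sign_avg ys 0.
  by move=> e; rewrite /t -e; exact: sum_le_sign_avg.
suff H zs ys : size (zs ++ ys) = size xs ->
    t *: (\sum_(x <- zs) absv x + \sum_(y <- ys) y) <=v sign_avg (zs ++ ys) 0.
  by have := H xs [::]; rewrite cats0 big_nil addr0; exact.
elim: zs ys => [|z zs IH] ys e; first by rewrite big_nil add0r; exact: base.
have e' u : size (zs ++ u :: ys) = size xs.
  by rewrite -e /= !size_cat /= addnS.
have h1 := IH (z :: ys) (e' _); have h2 := IH (- z :: ys) (e' _).
rewrite sign_avg_opp in h2; rewrite sign_avg_swap in h1 h2.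
rewrite big_cons addrCA in h1; rewrite big_cons addrCA in h2.
by rewrite big_cons -addrA [absv z + _]joinvD; exact: scale_joinv_le.
Qed.

Lemma bernoulli (a : R) n : 0 <= a -> a <= 1 -> 1 - n%:R * a <= (1 - a) ^+ n.
Proof.
move=> a0 a1; elim: n => [|n IH]; first by rewrite expr0 mul0r subr0.
have h : 0 <= n%:R * a * a by rewrite !mulr_ge0.
have : (1 - a) * (1 - n%:R * a) <= (1 - a) ^+ n.+1.
  by rewrite exprS ler_wpM2l// subr_ge0.
by apply: le_trans; rewrite -natr1; lra.
Qed.

(** The bound of order j for j^2 vectors comes from a Riesz product whose angle is
    of order 1 / j. The angle is chosen with rational sine s = 4 j / (4 j^2 + 1) and
    cosine c = 1 - 2 / (4 j^2 + 1); by Bernoulli's inequality c^(j^2) stays above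
    1 / 2. *)
Lemma khinchin f xs (j : nat) (eta : R) : positive f -> size xs = (j ^ 2)%N -> (0 < j)%N ->
  (forall x, x \in xs -> eta <= f (absv x)) ->
  2 * j%:R * eta <= 5 * f (sign_avg xs 0).
Proof.
move=> pf sx j0 xeta.
have fA : 0 <= f (sign_avg xs 0).
  apply: positive_ge0 => //; apply: lev_trans (sign_avg_ge_absv _ _); exact: absv_ge0.
have [eta0|/ltW eta0] := leP eta 0.
  by apply: (@le_trans _ _ 0); rewrite ?mulr_ge0// mulr_ge0_le0// mulr_ge0.
pose J : R := j%:R; pose D := 4 * J ^+ 2 + 1; pose s := 4 * J / D; pose c := 1 - 2 / D.
have J1 : 1 <= J by rewrite ler1n.
have J2 : 1 <= J ^+ 2 by rewrite expr_ge1// (le_trans _ J1).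
have D5 : 5 <= D by rewrite /D; lra.
have D0 : 0 < D by lra.
have d0 : 0 <= 2 / D by rewrite divr_ge0// ltW.
have d1 : 2 / D <= 1 by rewrite ler_pdivrMr//; lra.
have cs1 : c ^+ 2 + s ^+ 2 = 1.
  have Dn : D != 0 by rewrite gt_eqF.
  by rewrite /c /s /D in Dn *; field.
have s0 : 0 <= s by rewrite divr_ge0 ?mulr_ge0 ?(ltW D0)//; lra.
have := sum_abs_le_sign_avg xs (c := c) _ _ s0 cs1.
rewrite subr_ge0 d1 gerBl d0 => /(_ isT isT)/(positive_mono pf).
rewrite linearZ linear_sum /= -[_ *: _]/(_ * _) => h.
have cn : 2^-1 <= c ^+ size xs.
  apply: le_trans (bernoulli (size xs) d0 d1); rewrite sx natrX -/J.
  suff : J ^+ 2 * (2 / D) <= 2^-1 by lra.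
  by rewrite mulrA ler_pdivrMr// /D; lra.
have S : J ^+ 2 * eta <= \sum_(x <- xs) f (absv x).
  rewrite -natrX -sx mulr_natl -iter_addr_0 -(count_predT xs) -big_const_seq.
  by rewrite big_seq [leRHS]big_seq; apply: ler_sum => x xxs; exact: xeta.
apply: (@le_trans _ _ (5 * (s * 2^-1 * (J ^+ 2 * eta)))); last first.
  rewrite ler_wpM2l//; apply: le_trans h; apply: ler_pM => //.
  - by rewrite mulr_ge0.
  - by rewrite mulr_ge0// exprn_ge0// ltW.
  - by rewrite ler_wpM2l.
rewrite (_ : 5 * _ = 2 * J * eta * (5 * J ^+ 2 / D)); last first.
  by rewrite /s; field; rewrite gt_eqF.
apply: ler_peMr; first by rewrite !mulr_ge0// (le_trans ler01).
by rewrite ler_pdivlMr// /D; lra.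
Qed.

End sign_average.

(** * Positive sequences equivalent to the basis of c0 *)
Section c0_delta.
Variable R : realType.
Implicit Type u : c0 R.

Let c0_has_sup u : has_sup (range (fun n => `|u n|)).
Proof.
split; first by exists `|u 0%N|; exists 0%N.
have /c0_predP u0 := c0P u.
have : cvgn u by apply/cvg_ex; exists 0.
move=> /cvg_seq_bounded/pinfty_ex_gt0[M M0 uM].
by exists M => _ [n _ <-]; exact: uM.
Qed.

Lemma c0_norm_ge u n : `|u n| <= `|u|.
Proof. by apply: (sup_upper_bound (c0_has_sup u)); exists n. Qed.

Lemma c0_norm_le u (M : R) : (forall n, `|u n| <= M) -> `|u| <= M.
Proof.
move=> uM; apply: ge_sup; first by have [] := c0_has_sup u.
by move=> _ [n _ <-].
Qed.

Let finite_in_c0 (N : nat) (a : nat -> R) :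
  ((fun n => if (n < N)%N then a n else 0) : nat -> R^o) \in @c0_pred R.
Proof.
apply/c0_predP; apply: cvg_near_cst; exists N => // n /= Nn.
by rewrite ltnNge Nn.
Qed.

Definition c0_trunc N (a : nat -> R) : c0 R := C0 (finite_in_c0 N a).

Definition c0_delta i : c0 R := c0_trunc i.+1 (fun n => (n == i)%:R).

Lemma c0_deltaE i n : c0_delta i n = (n == i)%:R.
Proof.
rewrite /c0_delta /= ltnS; case: eqVneq => [->|ni]; first by rewrite leqnn.
by case: ifP.
Qed.

End c0_delta.

Section positive_c0_sequence.
Variables (R : realType) (E : banachLatticeType R).

Lemma sign_avg_c0_le (J : bop (c0 R) E) (I : seq nat) (a : c0 R) :
  uniq I -> (forall n, `|a n| <= 1) -> (forall i, i \in I -> a i = 0) ->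
  `|sign_avg [seq J (c0_delta R i) | i <- I] (J a)| <= `|J|.
Proof.
elim: I a => [|i I IH] a /=.
  move=> _ a1 _; rewrite norm_absv; apply: le_trans (opnormP _ _) _.
  by rewrite -[leRHS]mulr1 ler_wpM2l// c0_norm_le.
move=> /andP[iI uI] a1 aI; rewrite -linearD -linearB.
have step (b : R) : `|b| <= 1 ->
    `|sign_avg [seq J (c0_delta R i) | i <- I] (J (a + b *: c0_delta R i))| <= `|J|.
  move=> b1; apply: IH => // n.
    rewrite -[(_ + _ : c0 R) n]/(a n + b * c0_delta R i n) c0_deltaE.
    have [->|ni] := eqVneq n i; last by rewrite mulr0 addr0.
    by rewrite mulr1 aI ?mem_head// add0r.
  move=> nI; rewrite -[LHS]/(a n + b * c0_delta R i n) c0_deltaE aI ?inE ?nI ?orbT//.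
  rewrite add0r (_ : n == i = false) ?mulr0//.
  by apply/negbTE/eqP => ni; move: iI; rewrite -ni nI.
have h1 := step 1; have h2 := step (-1).
rewrite normrZ gtr0_norm ?invr_gt0// ler_pdivrMl// mulr_natl mulr2n.
apply: le_trans (ler_normD _ _) _; apply: lerD.
  by move: h1; rewrite normr1 scale1r; apply.
by move: h2; rewrite normrN1 scaleN1r; apply.
Qed.

(** A positive functional that is large on infinitely many |x_n| would, by
    [khinchin], make the averages over these x_n unbounded. *)
Lemma c0_seq_weakly_null_abs (x : nat -> E) (M : R) :
  (forall I, uniq I -> `|sign_avg [seq x i | i <- I] 0| <= M) ->
  forall (f : dual E) (eta : R), positive f -> 0 < eta ->
    \forall n \near \oo, f (absv (x n)) <= eta.
Proof.
move=> xM f eta pf eta0; apply: contrapT => H.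
have often N : exists2 n, (N <= n)%N & eta <= f (absv (x n)).
  apply: contrapT => HN; apply: H; exists N => // n /= Nn.
  by rewrite leNgt; apply/negP => /ltW fn; apply: HN; exists n.
have lists k : exists I : seq nat, [/\ uniq I, size I = k &
    forall i, i \in I -> eta <= f (absv (x i))].
  elim: k => [|k [I [uI sI fI]]]; first by exists [::].
  have [n nI fn] := often (\max_(i <- I) i).+1.
  exists (n :: I); split=> /=; last 2 first.
  - by rewrite sI.
  - by move=> i; rewrite inE => /predU1P[->//|]; exact: fI.
  rewrite uI andbT; apply/negP => nI'.
  by have := @leq_bigmax_seq _ I xpredT id n nI' isT; rewrite leqNgt nI.
pose j := (Num.truncn (5 * (`|f| * M) / (2 * eta))).+1.
have [I [uI sI fI]] := lists (j ^ 2)%N.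
have K : 2 * j%:R * eta <= 5 * f (sign_avg [seq x i | i <- I] 0).
  by apply: khinchin; rewrite ?size_map// => y /mapP[i iI ->]; exact: fI.
have fM : f (sign_avg [seq x i | i <- I] 0) <= `|f| * M.
  apply: le_trans (ler_norm _) _; apply: le_trans (opnormP _ _) _.
  by rewrite ler_wpM2l// xM.
have : 5 * (`|f| * M) / (2 * eta) < j%:R by exact: truncnS_gt.
rewrite ltr_pdivrMr ?mulr_gt0//; apply/negP; rewrite -leNgt.
apply: le_trans (_ : _ <= 5 * f (sign_avg [seq x i | i <- I] 0)) _; last by rewrite ler_pM2l.
by rewrite mulrCA mulrA.
Qed.

(** The off-diagonal sum leaves a margin delta below the diagonal, which is what
    the lower c0-estimate [almost_biorthogonal_lower] needs. *)
Definition almost_biorthogonal (e : nat -> E) (f : nat -> dual E) (delta : R) :=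
  forall n, [/\ positive (f n), `|f n| <= 1, 3 * delta <= f n (e n) &
    forall N, \sum_(i < N | i != n :> nat) f n (e i) <= 2 * delta].

(** Let x_n be the basis of the copy of c0. The sums of the |x_n| need not be
    bounded, so e_k is defined as the increment of the average over signs along a
    subsequence: the partial sums of the e_k are averages over signs of bounded
    vectors. Choose positive f_n of norm at most one whose value at |x_n| is at least
    the norm of x_n. The
    increment e_k is large at the functional of the k-th selected x_n as long as
    the previous average is small there, and it is dominated by the k-th selected
    |x_n|. The subsequence is therefore selected so that
    - each new |x_n| is small at the previously selected functionals, which is
      possible by [c0_seq_weakly_null_abs], and
    - the sum of the previous |x_i| is small at the new functional. This is
      possible if that sum is small at a limit phi of the f_n, and it is, since
      each |x_n| is also selected to be small at phi. *)
Lemma contains_c0_positive : contains_c0 E -> exists (e : nat -> E) (f : nat -> dual E)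
  (delta M : R), [/\ 0 < delta, forall n, 0 <=v e n,
    forall N, `|\sum_(i < N) e i| <= M & almost_biorthogonal e f delta].
Proof.
move=> [Z [_ [J [K [JZ JK Kc]]]]].
have [r r0 Jr] : exists2 r : R, 0 < r & forall i, r <= `|J (c0_delta R i)|.
  have K0 : K 0 = 0 by rewrite -{1}(linear0 J) JK.
  have Z0 : Z 0 by rewrite -JZ; exists 0 => //; rewrite linear0.
  have /subspace_continuousP/(_ _ Z0)/cvgrPdist_lt/(_ 1 ltr01) := Kc.
  rewrite -[from_subspace Z K 0]/(K 0) K0 => /nbhs_ballP[r /= r0 H]; exists r => // i.
  rewrite leNgt; apply/negP => Jr.
  have : `|0 - K (J (c0_delta R i))| < 1.
    by apply: H; [rewrite -ball_normE /= sub0r normrN|rewrite -JZ; exists (c0_delta R i)].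
  rewrite JK sub0r normrN; apply/negP; rewrite -leNgt.
  by have := c0_norm_ge (c0_delta R i) i; rewrite c0_deltaE eqxx normr1.
pose x i := J (c0_delta R i).
have xM I : uniq I -> `|sign_avg [seq x i | i <- I] 0| <= `|J|.
  move=> uI; rewrite -(linear0 J); apply: sign_avg_c0_le => // n.
  by rewrite normr0.
have xw := c0_seq_weakly_null_abs xM.
(* Of the 4 delta that f_n has at |x_n|, one delta is lost on the diagonal to the
   previous average; off the diagonal, the earlier indices contribute at most one
   delta, and the later ones at most the sum of the eta k, again delta. *)
pose delta := r / 4.
have delta0 : 0 < delta by rewrite divr_gt0.
have [f /all_and3[pf f1 fx]] := choice (fun n => norming_positive (absv (x n))).
have fr n : 4 * delta <= f n (absv (x n)).
  apply: le_trans (fx n); rewrite posv_id; last exact: absv_ge0.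
  by rewrite norm_absv mulrC divfK ?pnatr_eq0// Jr.
have [phi _ phiP] := dual_limit f1.
have pphi : positive phi.
  move=> u u0; rewrite /lev /=; apply: phiP; apply: nearW => n.
  exact: positive_ge0.
pose eta k : R := delta / 2 ^+ k.+1.
have eta0 k : 0 < eta k by rewrite divr_gt0// exprn_gt0.
pose S (I : seq nat) := \sum_(i <- I) absv (x i).
have step (I : seq nat) : exists n, [/\ n \notin I, phi (absv (x n)) <= eta (size I),
    forall i, i \in I -> f i (absv (x n)) <= eta (size I) &
    phi (S I) < delta -> f n (S I) < delta].
  have ev : \forall n \near \oo, [/\ n \notin I, phi (absv (x n)) <= eta (size I) &
      forall i, i \in I -> f i (absv (x n)) <= eta (size I)].
    suff : \forall n \near \oo, forall i, i \in I ->
        n != i /\ f i (absv (x n)) <= eta (size I).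
      move=> H; near=> n.
      have Hn : forall i, i \in I -> n != i /\ f i (absv (x n)) <= eta (size I) by near: n.
      split; last by move=> i /Hn[].
      - by apply/negP => /Hn[]; rewrite eqxx.
      - by near: n; exact: xw.
    move: (size I) => k; elim: I => [|i I IH]; first by apply: nearW.
    have h : \forall n \near \oo, n != i /\ f i (absv (x n)) <= eta k.
      near=> n; split; last by near: n; apply: xw.
      by rewrite neq_ltn; apply/orP; right; near: n; exists i.+1.
    near=> n => j; rewrite inE => /predU1P[->|].
      by near: n.
    by move: j; near: n.
  apply: contrapT => H.
  have [phiS|phiS] := ltP (phi (S I)) delta; last first.
    have [n [h1 h2 h3]] := filter_ex ev; apply: H; exists n; split=> //.
    by rewrite ltNge phiS.
  have : delta <= phi (S I).
    apply: phiP; apply: filterS ev => n [h1 h2 h3].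
    by rewrite leNgt; apply/negP => fS; apply: H; exists n.
  by rewrite leNgt phiS.
have [g gP] := choice step.
pose L := fix L k : seq nat := if k is k'.+1 then g (L k') :: L k' else [::].
have sL k : size (L k) = k by elim: k => //= k ->.
have uL k : uniq (L k).
  by elim: k => //= k ->; rewrite andbT; have [] := gP (L k).
have memL i k : (i < k)%N -> g (L i) \in L k.
  elim: k => // k IH; rewrite ltnS leq_eqVlt => /predU1P[->|/IH] /=.
    by rewrite mem_head.
  by rewrite inE => ->; rewrite orbT.
have phiL k : phi (S (L k)) < delta.
  suff : phi (S (L k)) <= delta - delta / 2 ^+ k.
    by move=> h; apply: le_lt_trans h _; rewrite gtrBl divr_gt0// exprn_gt0.
  elim: k => [|k IH]; first by rewrite /S big_nil linear0 expr0 divr1 subrr.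
  have [_ h _ _] := gP (L k); rewrite sL in h.
  rewrite /S /= big_cons linearD -/(S _).
  have : delta / 2 ^+ k = eta k + eta k.
    by rewrite /eta exprSr invfM mulrA -splitr.
  by move: IH h; rewrite -/(eta k) /=; move: (phi _) (phi _) => a b; lra.
pose A k := sign_avg [seq x i | i <- L k] 0.
have A0 : A 0%N = 0 by rewrite /A /= absv_id//; exact: lev_refl.
pose e k := A k.+1 - A k; pose F k := f (g (L k)).
have pF k : positive (F k) by exact: pf.
have e0 k : 0 <=v e k by apply: (lev_subr _ _).1; exact: sign_avg_cons_ge.
have sumA N : \sum_(i < N) e i = A N.
  by elim: N => [|N IH]; rewrite ?big_ord0 ?A0// big_ord_recr /= IH /e addrC subrK.
have FA k : F k (A k) < delta.
  have [_ _ _ h] := gP (L k); apply: le_lt_trans (h (phiL k)).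
  apply: positive_mono => //; rewrite /A /S; apply: lev_trans (sign_avg_le_sum _) _.
  by rewrite big_map; exact: lev_refl.
exists e, F, delta, `|J|; split=> [//|//|N|n]; first by rewrite sumA; exact: xM.
split; [exact: pF|exact: f1| |move=> N].
  rewrite /e linearB /=; have := FA n; have := fr (g (L n)).
  have : F n (absv (x (g (L n)))) <= F n (A n.+1).
    by apply: positive_mono => //; exact: sign_avg_ge_head.
  rewrite -/(F n); move: (F n _) (F n _) (F n _) => a b c; lra.
have Fmono i j : (i <= j)%N -> F n (A i) <= F n (A j).
  move=> /subnK <-; elim: (j - i)%N => [//|k IH]; apply: le_trans IH _.
  by apply: positive_mono => //; exact: sign_avg_cons_ge.
suff : \sum_(i < N | i != n :> nat) F n (e i) <=
    F n (A (minn N n)) + (delta - delta / 2 ^+ N).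
  move=> h; apply: le_trans h _; have := Fmono _ _ (geq_minr N n); have := FA n.
  have : 0 < delta / 2 ^+ N by rewrite divr_gt0// exprn_gt0.
  by move: (F n _) (F n _) (_ / _) => a b c; lra.
elim: N => [|N IH].
  by rewrite big_ord0 min0n A0 linear0 expr0 divr1 subrr addr0.
have etaN : delta / 2 ^+ N = eta N + eta N.
  by rewrite /eta exprSr invfM mulrA -splitr.
have h0 := eta0 N; rewrite big_mkcond big_ord_recr -big_mkcond /= -/(eta N).
case: (ltngtP N n) => Nn /=.
- rewrite (minn_idPl Nn); rewrite (minn_idPl (ltnW Nn)) in IH.
  have -> : F n (A N.+1) = F n (A N) + F n (e N) by rewrite -linearD /e addrC subrK.
  by move: IH; move: (F n _) (F n _) => a b; lra.
- rewrite (minn_idPr (leqW (ltnW Nn))); rewrite (minn_idPr (ltnW Nn)) in IH.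
  have eN : F n (e N) <= eta N.
    have [_ _ h _] := gP (L N); rewrite sL in h; apply: le_trans (h _ (memL _ _ Nn)).
    apply: positive_mono => //; rewrite /e.
    have := sign_avg_cons_le [seq x i | i <- L N] (x (g (L N))) 0.
    by move=> /(lev_add2r (- A N)); rewrite [A N + _]addrC addrK.
  by move: IH eN; move: (F n _) (F n _) => a b; lra.
- subst n; rewrite minnn in IH; rewrite addr0 (minn_idPr (leqnSn N)).
  by move: IH; move: (F N _) => a; lra.
Unshelve. all: by end_near. Qed.

Lemma almost_biorthogonal_lower (e : nat -> E) (f : nat -> dual E) (delta : R)
    (N : nat) (a : nat -> R) :
  0 < delta -> (forall n, 0 <=v e n) -> almost_biorthogonal e f delta ->
  forall n, (n < N)%N -> delta * `|a n| <= `|\sum_(i < N) a i *: e i|.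
Proof.
move=> delta0 e0 ef n nN; pose i0 : 'I_N := Ordinal nN.
have [m _ mmax] := @arg_maxP _ _ _ i0 xpredT (fun i : 'I_N => `|a i|) isT.
have [pf f1 fe off] := ef m.
apply: (@le_trans _ _ (delta * `|a m|)).
  by rewrite ler_wpM2l ?(ltW delta0)//; exact: (mmax i0).
apply: (@le_trans _ _ `|f m (\sum_(i < N) a i *: e i)|); last first.
  by apply: le_trans (opnormP _ _) _; rewrite ler_piMl.
rewrite linear_sum (bigD1 m)//= linearZ /= -[_ *: _]/(a m * _).
set r := \sum_(i < N | _) _.
have rle : `|r| <= `|a m| * (2 * delta).
  apply: le_trans (ler_norm_sum _ _ _) _; apply: le_trans (ler_wpM2l _ (off N)) => //.
  rewrite mulr_sumr; apply: ler_sum => i _.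
  rewrite linearZ /= -[_ *: _]/(a i * _) normrM.
  rewrite (ger0_norm (positive_ge0 pf (e0 i))) ler_wpM2r//; last exact: mmax.
  exact: positive_ge0.
have h : `|a m| * (3 * delta) <= `|a m * f m (e m)|.
  by rewrite normrM ler_wpM2l// (le_trans fe)// ler_norm.
have := lerB_normD (a m * f m (e m)) r.
by move: rle h; move: (`|a m|) (`|r|) (`|_ * _|) (`|_ + _|) => x y z w; lra.
Qed.

(** The prescribed values form a linear subspace of constraints, and the lower
    c0-estimate is what [cone_separation] requires. *)
Lemma biorthogonal_functionals (e : nat -> E) (f : nat -> dual E) (delta : R) :
  0 < delta -> (forall n, 0 <=v e n) -> almost_biorthogonal e f delta ->
  exists h : nat -> dual E, (forall n, `|h n| <= delta^-1) /\
    forall n m, h n (e m) = (m == n)%:R.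
Proof.
move=> delta0 e0 ef; have lower N a n := @almost_biorthogonal_lower e f delta N a delta0 e0 ef n.
suff : forall n, exists h : dual E, `|h| <= delta^-1 /\ forall m, h (e m) = (m == n)%:R.
  by move=> /choice[h /all_and2[h1 h2]]; exists h.
move=> n.
pose D : set (E * R) := [set d | exists N (a : nat -> R),
  [/\ (n < N)%N, forall i, (N <= i)%N -> a i = 0, d.2 = a n & d.1 = \sum_(i < N) a i *: e i]].
have pad N N' (a : nat -> R) : (forall i, (N <= i)%N -> a i = 0) -> (N <= N')%N ->
    \sum_(i < N) a i *: e i = \sum_(i < N') a i *: e i.
  move=> aN NN'; rewrite (big_ord_widen_cond N' xpredT (fun i => a i *: e i))// big_mkcond.
  by apply: eq_bigr => i _; case: ltnP => // /aN ->; rewrite scale0r.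
have di0 : 0 <= delta^-1 by rewrite invr_ge0 ltW.
have [|[x r] [N [a [nN _ /= -> ->]]]|h h1 hD] := @cone_separation _ _ D delta^-1 di0.
- split=> [|[x r] [y s] [N [a [nN aN /= -> ->]]] [N' [b [nN' bN /= -> ->]]]|c [x r] c0 [N [a [nN aN /= -> ->]]]].
  + exists n.+1, (fun=> 0); split=> //=; rewrite big1// => i _.
    by rewrite scale0r.
  + exists (maxn N N'), (fun i => a i + b i); split=> //=.
    * by rewrite leq_max nN.
    * by move=> i; rewrite geq_max => /andP[/aN -> /bN ->]; rewrite addr0.
    * rewrite (pad _ _ _ aN (leq_maxl N N')) (pad _ _ _ bN (leq_maxr N N')) -big_split.
      by apply: eq_bigr => i _; rewrite scalerDl.
  + exists N, (fun i => c * a i); split=> //= [i /aN ->|]; first by rewrite mulr0.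
    by rewrite scaler_sumr; apply: eq_bigr => i _; rewrite scalerA.
- by rewrite /= ler_pdivlMl//; apply: le_trans (lower _ _ _ nN); rewrite ler_pM2l// ler_norm.
exists h; split=> // m.
(* Used for c = 1 and for c = -1, which bounds h (e m) from both sides. *)
have sel (c : R) : D (c *: e m, c * (m == n)%:R).
  exists (maxn n m).+1, (fun i => if i == m then c else 0); split=> /=.
  - by rewrite ltnS leq_maxl.
  - by move=> i; case: eqVneq => // ->; rewrite gtn_max ltnn andbF.
  - by rewrite eq_sym; case: eqP; rewrite ?mulr1 ?mulr0.
  - have mm : (m < (maxn n m).+1)%N by rewrite ltnS leq_maxr.
    rewrite (bigD1 (Ordinal mm))//= eqxx big1 ?addr0// => i im.
    by rewrite (_ : (i : nat) == m = false) ?scale0r//; apply: negbTE.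
apply/eqP; rewrite eq_le; apply/andP; split.
  have := hD _ (sel (-1)); rewrite /= linearZ /= -[_ *: _]/(_ * _); lra.
by have := hD _ (sel 1); rewrite /= scale1r mul1r.
Qed.

(** The sum is at most the value of |g| at the partial sum of the e_i. *)
Lemma sum_functional_le (e : nat -> E) (M : R) (g : dual E) N :
  (forall n, 0 <=v e n) -> (forall N, `|\sum_(i < N) e i| <= M) ->
  \sum_(i < N) `|g (e i)| <= M * `|g|.
Proof.
move=> e0 eM; apply: (@le_trans _ _ (absv g (\sum_(i < N) e i))).
  rewrite linear_sum; apply: ler_sum => i _.
  by have := dual_absv_le g (e i); rewrite (absv_id (e0 i)).
apply: le_trans (ler_norm _) _; apply: le_trans (opnormP _ _) _.
by rewrite mulrC norm_absv ler_wpM2r.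
Qed.

End positive_c0_sequence.

(** * Operators given by series *)
Section limits_in_lattices.
Variables (R : realType) (V : banachLatticeType R).

Lemma cvg_norm_le (s : nat -> V) (l : V) (B : R) :
  (forall n, `|s n| <= B) -> s @ \oo --> l -> `|l| <= B.
Proof.
move=> sB sl; apply/ler_addgt0Pr => e e0.
have /cvgrPdist_le/(_ _ e0)/filter_ex[n /= nl] := sl.
rewrite -[l](subrK (s n)) (le_trans (ler_normD _ _))// addrC lerD//.
Qed.

Lemma cvg_lev_ge0 (s : nat -> V) (l : V) :
  (\forall n \near \oo, 0 <=v s n) -> s @ \oo --> l -> 0 <=v l.
Proof.
move=> s0 sl; suff : `|posv (- l)| <= 0.
  by rewrite normr_le0 => /eqP/posv_eq0/lev_opp; rewrite opprK oppr0.
apply/ler_addgt0Pr => e e0; rewrite add0r.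
have /cvgrPdist_le/(_ _ e0)/(filterI s0)/filter_ex[n [/= sn nl]] := sl.
apply: le_trans nl; rewrite distrC; apply: le_trans (norm_posv_le _).
apply: normv_le; first exact: posv_ge0.
apply: posv_mono; rewrite -[X in X <=v _]add0r; exact: lev_add2r.
Qed.

End limits_in_lattices.

Section regular_norm.
Variables (R : realType) (X Y : banachLatticeType R).

Lemma regnorm_le (T : regop X Y) (S : bop X Y) : Defs.dominated_by T S -> `|T| <= `|S|.
Proof.
move=> TS; rewrite -[leLHS]/(regnorm T).
by apply: ge_inf; [exists 0 => _ [? _ <-]|exists S].
Qed.

Lemma opnorm_le_regnorm (T : regop X Y) : `|regop_val T| <= `|T|.
Proof.
rewrite -[leRHS]/(regnorm T); apply: lb_le_inf.
  have /regular_predP[S1 [S2 [p1 p2 e]]] := regopP T.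
  exists `|S1 + S2|, (S1 + S2) => //; split=> [x x0|x].
    by rewrite bopD; apply: addv_ge0; [exact: p1|exact: p2].
  have H (S : bop X Y) : positive S -> absv (S x) <=v S (absv x).
    move=> pS; apply: absv_le; apply: (lev_subr _ _).2.
      by rewrite -linearB; apply: pS; apply: (lev_subr _ _).1; exact: absv_ge.
    rewrite opprK -linearD; apply: pS.
    by have := (lev_subr _ _).1 (absv_geN x); rewrite opprK.
  rewrite e bopB bopD; apply: lev_trans (absvD _ _) _.
  by rewrite absvN; apply: lev_add; exact: H.
move=> _ [S [pS TS] <-]; apply: bop_norm_le => // x.
rewrite -(norm_absv (T x)) -(norm_absv x).
by apply: le_trans (opnormP S _); apply: normv_le; [exact: absv_ge0|exact: TS].
Qed.

End regular_norm.

Section series_operators.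
Variables (R : realType) (E F : banachLatticeType R).
Variables (e : nat -> E) (M : R).
Hypothesis e0 : forall n, 0 <=v e n.
Hypothesis eM : forall N, `|\sum_(i < N) e i| <= M.
Implicit Types (z : nat -> F) (g : dual E).

Definition coef_series z g : nat -> F := series (fun k => g (e k) *: z k).

Let M0 : 0 <= M. Proof. by apply: le_trans (eM 0%N). Qed.

Let coef_sum_le z (B : R) g N : (forall k, `|z k| <= B) ->
  \sum_(0 <= k < N) `|g (e k) *: z k| <= M * B * `|g|.
Proof.
move=> zB; have B0 : 0 <= B by apply: le_trans (zB 0%N).
rewrite big_mkord mulrAC.
apply: le_trans (ler_wpM2r B0 (sum_functional_le g N e0 eM)).
by rewrite mulr_suml; apply: ler_sum => i _; rewrite normrZ ler_wpM2l.
Qed.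

Lemma coef_series_cvg z (B : R) g : (forall k, `|z k| <= B) -> cvgn (coef_series z g).
Proof.
move=> zB; apply: normed_cvg; apply: nondecreasing_is_cvgn.
  apply/nondecreasing_seqP => n.
  by rewrite /series /= [leRHS]big_nat_recr//= lerDl.
by exists (M * B * `|g|) => _ [N _ <-]; exact: coef_sum_le.
Qed.

Lemma series_bop z (B : R) : (forall k, `|z k| <= B) ->
  exists2 T : bop (dual E) F, (forall g, coef_series z g @ \oo --> T g) & `|T| <= M * B.
Proof.
move=> zB; have B0 : 0 <= B by apply: le_trans (zB 0%N).
have cz g : cvgn (coef_series z g) := coef_series_cvg zB.
pose T g : F := lim (coef_series z g @ \oo).
have lT : linear T.
  move=> a f g; apply: (norm_cvg_unique (cz (a *: f + g))).
  have -> : coef_series z (a *: f + g) =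
      (fun n => a *: coef_series z f n + coef_series z g n).
    apply/funext => n; rewrite /coef_series /series /= scaler_sumr -big_split /=.
    by apply: eq_bigr => k _; rewrite scalerA -scalerDl.
  by apply: cvgD; [apply: cvgZr; exact: cz|exact: cz].
have TM g : `|T g| <= M * B * `|g|.
  apply: cvg_norm_le (cz g) => n.
  by apply: le_trans (ler_norm_sum _ _ _) _; exact: coef_sum_le.
exists (Bop (bop_bound lT TM)) => [g|]; first exact: cz.
by apply: bop_norm_le => //; rewrite mulr_ge0.
Qed.

(** The operator S given by the |z k| dominates T, since the e k are positive;
    so S and S - T are positive and T is regular with norm at most that of S. *)
Lemma series_regop z (B : R) : (forall k, `|z k| <= B) ->
  exists2 T : regop (dual E) F, (forall g, coef_series z g @ \oo --> T g) & `|T| <= M * B.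
Proof.
move=> zB; have [T Tz _] := series_bop zB.
have [|S Sz SM] := @series_bop (fun k => absv (z k)) B.
  by move=> k; rewrite norm_absv.
have pS : positive S.
  move=> g /bop_ge0P pg; apply: cvg_lev_ge0 (Sz g); apply: nearW => n.
  apply: sumv_ge0 => k _; apply: scalev_ge0; last exact: absv_ge0.
  exact: positive_ge0.
have dom (c : R) (g f : dual E) : (forall k, c * g (e k) <= f (e k)) -> (forall k, - (c * g (e k)) <= f (e k)) ->
    c *: T g <=v S f.
  move=> h1 h2; apply: (lev_subr _ _).2.
  have : (fun n => coef_series (fun k => absv (z k)) f n - c *: coef_series z g n) @ \oo
      --> S f - c *: T g by apply: cvgB; [exact: Sz|apply: cvgZr; exact: Tz].
  apply: cvg_lev_ge0; apply: nearW => n.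
  rewrite /coef_series /series /= scaler_sumr -sumrB.
  apply: sumv_ge0 => k _; apply: (lev_subr _ _).1; rewrite scalerA.
  apply: lev_trans (absv_ge _) _; rewrite absvZ; apply: (lev_subr _ _).2; rewrite -scalerBl.
  apply: scalev_ge0; last exact: absv_ge0.
  by rewrite subr_ge0 ler_norml lerNl h1 h2.
have dTS : Defs.dominated_by T S.
  split=> // g; have h k := dual_absv_le g (e k).
  have {}h k : `|g (e k)| <= absv g (e k) by have := h k; rewrite (absv_id (e0 k)).
  have hp k : g (e k) <= absv g (e k) by exact: le_trans (ler_norm _) (h k).
  have hm k : - g (e k) <= absv g (e k).
    by apply: le_trans (h k); rewrite -normrN; exact: ler_norm.
  apply: absv_le.
    by have := dom 1 g (absv g); rewrite scale1r; apply=> k; rewrite mul1r.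
  have := dom (-1) g (absv g); rewrite scaleN1r.
  by apply=> k; rewrite mulN1r ?opprK.
have rT : T \in @regular_pred R (dual E) F.
  apply/regular_predP; exists S, (S - T); split=> //; last by rewrite opprB addrCA subrr addr0.
  move=> g /bop_ge0P pg; rewrite bopB; apply: (lev_subr _ _).1.
  have := dom 1 g g; rewrite scale1r; apply=> k; rewrite mul1r//.
  by have := positive_ge0 pg (e0 k); move: (g (e k)) => a; lra.
exists (RegOp rT) => //.
by apply: le_trans SM; exact: regnorm_le.
Qed.

(** Truncating the series leaves the operator of a sequence with small supremum,
    so the partial sums, which are tensors, converge in the regular norm. *)
Lemma series_wittstock z (B : R) : (forall k, `|z k| <= B) -> z @ \oo --> (0 : F) ->
  exists2 T : wittstock E F, (forall g, coef_series z g @ \oo --> T g) & `|T| <= M * B.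
Proof.
move=> zB z0; have [T Tz TM] := series_regop zB.
suff cT : T \in @wittstock_pred R E F by exists (Wittstock cT).
apply/wittstock_predP => A /nbhs_ballP[r /= r0 rA].
have M1 : 0 < M + 1 by rewrite ltr_wpDl.
have d0 : 0 < r / (M + 1) by rewrite divr_gt0.
have /cvgrPdist_le/(_ _ d0)[N _ HN] := z0.
pose u := [seq (e k, z k) | k <- iota 0 N].
exists (tensor u); split; first by exists u.
apply: rA; rewrite -ball_normE /=.
pose z' k := if (k < N)%N then 0 else z k.
have [|T' T'z T'M] := @series_regop z' (r / (M + 1)).
  move=> k; rewrite /z'; case: ltnP => kN; first by rewrite normr0 ltW.
  by have := HN k kN; rewrite /= sub0r normrN.
have -> : T - tensor u = T'.
  apply/val_inj/bopE => g; rewrite -[LHS]/(T g - tensor u g).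
  apply: norm_cvg_unique (T'z g); apply: cvg_trans; last first.
    by apply: cvgB (Tz g) _; exact: cvg_cst.
  apply: near_eq_cvg; exists N => // n /= Nn.
  apply/esym; have -> : tensor u g = \sum_(0 <= k < N) g (e k) *: z k.
    by rewrite tensorE big_map /index_iota subn0.
  rewrite /coef_series /series /= [LHS](big_cat_nat _ (n := N))//= big1_seq ?add0r.
    rewrite -[RHS]/(\sum_(0 <= k < n) _ - \sum_(0 <= k < N) _).
    rewrite [X in _ = X - _](big_cat_nat _ (n := N))//= [X in _ = X - _]addrC addrK.
    by apply: eq_big_nat => k /andP[Nk _]; rewrite /z' ltnNge Nk.
  by move=> k /=; rewrite mem_index_iota /z' => /andP[_ ->]; rewrite scaler0.
apply: le_lt_trans T'M _.
by rewrite mulrCA gtr_pMr// ltr_pdivrMr// mul1r ltrDl.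
Qed.

End series_operators.

(** * Copies of c0 and weak-star null sequences in the tensor product *)
Lemma bop_sumE (R : realType) (X Y : normedModType R) (I : Type) (r : seq I)
    (P : pred I) (f : I -> bop X Y) x :
  (\sum_(i <- r | P i) f i) x = \sum_(i <- r | P i) f i x.
Proof. by elim/big_rec2: _ => // i u T _ <-. Qed.

Section block_sequences.
Variables (R : realType) (F : banachLatticeType R).
Variables (m : nat -> nat) (y : nat -> nat -> F).
Hypothesis y1 : forall n j, `|y n j| <= 1.

(** The family of the a_n y_(n,j), read as a sequence through the enumeration of
    pairs and padded with zeros. *)
Definition block (a : nat -> R) (k : nat) : F :=
  if @pickle_inv (nat * nat)%type k is Some (n, j) then
    if (j < m n)%N then a n *: y n j else 0
  else 0.

Lemma block_pickle a n j : (j < m n)%N -> block a (pickle (n, j)) = a n *: y n j.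
Proof. by move=> jm; rewrite /block pickleK_inv jm. Qed.

Lemma block_norm_le a (B : R) : (forall n, `|a n| <= B) -> forall k, `|block a k| <= B.
Proof.
move=> aB k; have B0 : 0 <= B by apply: le_trans (aB 0%N).
rewrite /block; case: pickle_inv => [[n j]|]; rewrite ?normr0//.
by case: ifP => _; rewrite ?normr0// normrZ (le_trans _ (aB n))// ler_piMr.
Qed.

Lemma block_linear c a b k :
  block (fun n => c * a n + b n) k = c *: block a k + block b k.
Proof.
rewrite /block; case: pickle_inv => [[n j]|]; last by rewrite scaler0 addr0.
by case: ifP => _; rewrite ?scaler0 ?addr0// scalerDl scalerA.
Qed.

Lemma block_cvg0 (a : nat -> R^o) : a @ \oo --> (0 : R^o) -> block a @ \oo --> (0 : F).
Proof.
move=> a0; apply/cvgrPdist_le => eps eps0.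
have /cvgrPdist_le/(_ _ eps0)[N _ aN] := a0.
(* Only finitely many positions belong to pairs (n, j) with n < N and j < m n. *)
exists (\max_(n < N) \max_(j < m n) pickle (n : nat, j : nat)).+1 => // k /= Nk.
rewrite sub0r normrN /block; case ek : pickle_inv => [[n j]|]; last by rewrite normr0 ltW.
case: ifP => jm; last by rewrite normr0 ltW.
have nN : (N <= n)%N.
  rewrite leqNgt; apply/negP => nN; move: Nk; rewrite ltnNge => /negP; apply.
  have -> : k = pickle (n, j).
    by have := @pickle_invK (nat * nat)%type k; rewrite ek.
  apply: leq_trans (leq_bigmax (F := fun n : 'I_N => \max_(j < m n) pickle (n : nat, j : nat)) (Ordinal nN)).
  exact: (leq_bigmax (F := fun j : 'I_(m n) => pickle (n, j : nat)) (Ordinal jm)).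
rewrite normrZ; have := aN n nN; rewrite sub0r normrN => h.
by rewrite (le_trans _ h)// ler_piMr.
Qed.

End block_sequences.

Section c0_embedding.
Variables (R : realType) (E F : banachLatticeType R).
Variables (e : nat -> E) (M : R).
Hypothesis e0 : forall n, 0 <=v e n.
Hypothesis eM : forall N, `|\sum_(i < N) e i| <= M.
Variables (m : nat -> nat) (y : nat -> nat -> F).
Hypothesis y1 : forall n j, `|y n j| <= 1.

Lemma c0_embedding : exists J : bop (c0 R) (wittstock E F),
  forall (a : c0 R) g, coef_series e (block m y a) g @ \oo --> J a g.
Proof.
have ex (a : c0 R) : exists T : wittstock E F,
    (forall g, coef_series e (block m y a) g @ \oo --> T g) /\ `|T| <= M * `|a|.
  have [||T Tz TM] := @series_wittstock _ E F e M e0 eM (block m y a) `|a|.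
  - by apply: block_norm_le => // n; exact: c0_norm_ge.
  - by apply: block_cvg0 => //; apply/c0_predP; exact: c0P.
  by exists T.
have [J /all_and2[Ja JM]] := choice ex.
have lJ : linear J.
  move=> c a b; apply/val_inj/val_inj/bopE => g.
  rewrite -[RHS]/(c *: J a g + J b g).
  apply: norm_cvg_unique (Ja (c *: a + b) g) _.
  have -> : coef_series e (block m y (c *: a + b)) g =
      (fun n => c *: coef_series e (block m y a) g n + coef_series e (block m y b) g n).
    apply/funext => n; rewrite /coef_series /series /= scaler_sumr -big_split /=.
    apply: eq_bigr => k _; rewrite (block_linear m y c a b k) scalerDr !scalerA.
    by rewrite [c * _]mulrC.
  by apply: cvgD; [apply: cvgZr; exact: Ja|exact: Ja].
by exists (Bop (bop_bound lJ JM)).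
Qed.

End c0_embedding.

Section block_functionals.
Variables (R : realType) (E F : banachLatticeType R).
Variables (h : nat -> dual E) (D : R).
Hypothesis hD : forall n, `|h n| <= D.
Variables (m : nat -> nat) (g : nat -> nat -> dual F) (y : nat -> nat -> F).
Hypothesis gy : forall n, spread_family (n.+1%:R^-1) (m n) (g n) (y n).

Let D0 : 0 <= D. Proof. by apply: le_trans (hD 0%N). Qed.

Definition block_fun n (T : regop (dual E) F) : R^o :=
  \sum_(j < m n) g n j (T (h (pickle (n, j : nat)))).

Lemma block_fun_linear n : linear (block_fun n).
Proof.
move=> c S T; rewrite /block_fun scaler_sumr -big_split; apply: eq_bigr => j _ /=.
by rewrite -[LHS]/(g n j (c *: S (h _) + T (h _))) linearP.
Qed.

Lemma block_fun_le n T : `|block_fun n T| <= 2 * D * `|T|.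
Proof.
have [_ _ g2 _] := gy n.
apply: le_trans (ler_norm_sum _ _ _) _.
apply: (@le_trans _ _ (\sum_(j < m n) `|g n j| * (D * `|T|))); last first.
  by rewrite -mulr_suml -mulrA ler_wpM2r// mulr_ge0.
apply: ler_sum => j _; apply: le_trans (opnormP _ _) _.
rewrite ler_wpM2l//; apply: le_trans (opnormP _ _) _; rewrite mulrC.
by apply: ler_pM => //; [exact: hD|exact: opnorm_le_regnorm].
Qed.

(** The numbers h_(n,j)(x), divided by a bound for them, are multipliers for the
    family g n. *)
Lemma block_fun_tensor1 n x v : `|block_fun n (tensor1 x v)| <= D * `|x| * `|v| / n.+1%:R.
Proof.
have [_ _ _ gt] := gy n.
pose c := D * `|x|; have c0' : 0 <= c by rewrite mulr_ge0.
have hx k : `|h k x| <= c by apply: le_trans (opnormP _ _) _; rewrite ler_wpM2r.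
have -> : block_fun n (tensor1 x v) = (\sum_(j < m n) h (pickle (n, j : nat)) x *: g n j) v.
  rewrite bop_sumE; apply: eq_bigr => j _.
  by rewrite -[tensor1 x v _]/(h _ x *: v) linearZ.
apply: le_trans (opnormP _ _) _; rewrite mulrAC ler_wpM2r//.
have [c00|cn] := eqVneq c 0.
  rewrite big1 ?normr0 ?divr_ge0// => j _.
  have := hx (pickle (n, j : nat)); rewrite c00 normr_le0 => /eqP ->.
  by rewrite scale0r.
have cp : 0 < c by rewrite lt_neqAle eq_sym cn.
have -> : \sum_(j < m n) h (pickle (n, j : nat)) x *: g n j =
    c *: \sum_(j < m n) (h (pickle (n, j : nat)) x / c) *: g n j.
  by rewrite scaler_sumr; apply: eq_bigr => j _; rewrite scalerA mulrC divfK.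
rewrite normrZ (ger0_norm c0') ler_wpM2l//.
apply: (gt (fun j => h (pickle (n, j)) x / c)) => j.
by rewrite normrM normfV (ger0_norm c0') ler_pdivrMr// mul1r.
Qed.

(** Uniform boundedness reduces the claim to tensors. *)
Lemma block_fun_cvg0 (T : wittstock E F) : block_fun n T @[n --> \oo] --> (0 : R^o).
Proof.
apply/cvgrPdist_le => eps eps0.
have d0 : 0 < eps / 2 / (2 * D + 1) by rewrite !divr_gt0// ltr_wpDl// mulr_ge0.
have /wittstock_predP/(_ _ (nbhsx_ballx _ _ d0))[_ [[u _ <-]]] := wittstockP T.
rewrite -ball_normE /= => Tu.
have [C C0 uC] : exists2 C, 0 <= C & forall n, `|block_fun n (tensor u)| <= C / n.+1%:R.
  elim: {Tu} u => [|[x v] u [C C0 uC]].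
    exists 0 => // n; rewrite mul0r /tensor big_nil.
    by rewrite (_ : block_fun n 0 = 0) ?normr0// /block_fun big1// => j _; rewrite linear0.
  exists (D * `|x| * `|v| + C); first by rewrite addr_ge0// !mulr_ge0.
  move=> n; rewrite /tensor big_cons -[in X in X + _](scale1r (tensor1 _ _)) block_fun_linear.
  rewrite scale1r mulrDl (le_trans (ler_normD _ _))// lerD//; first exact: block_fun_tensor1.
exists (Num.truncn (C / (eps / 2))) => // n /= Nn.
rewrite sub0r normrN -[T : regop _ _](subrK (tensor u)).
rewrite -[X in X + tensor u]scale1r block_fun_linear scale1r.
rewrite (le_trans (ler_normD _ _))// [leRHS]splitr lerD//.
  apply: le_trans (block_fun_le _ _) _.
  apply: (@le_trans _ _ (2 * D * (eps / 2 / (2 * D + 1)))).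
    by rewrite ler_wpM2l ?mulr_ge0// ltW.
  by rewrite mulrCA ler_piMr ?ler_pdivrMr ?mul1r ?lerDl// ?divr_ge0 ?ltW// ltr_wpDl// mulr_ge0.
apply: le_trans (uC n) _; rewrite ler_pdivrMr// mulrC -ler_pdivrMr ?divr_gt0//.
rewrite ltW// (lt_le_trans (truncnS_gt _))// ler_nat ltnS//.
Qed.

Let witt_bop n : (fun T : wittstock E F => block_fun n T) \in @bop_pred R (wittstock E F) R^o.
Proof.
apply: (@bop_bound _ _ _ _ (2 * D)) => [c S T|T]; last exact: block_fun_le.
exact: block_fun_linear.
Qed.

Definition block_functional n : dual (wittstock E F) := Bop (witt_bop n).

Lemma block_functional_norm_le n : `|block_functional n| <= 2 * D.
Proof. by apply: bop_norm_le => [|T]; [rewrite mulr_ge0|exact: block_fun_le]. Qed.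

Lemma block_functional_weakstar_null : weakstar_null block_functional.
Proof. exact: block_fun_cvg0. Qed.

End block_functionals.

Section complemented_copy.
Variables (R : realType) (X : normedModType R) (J : bop (c0 R) X) (phi : nat -> dual X).
Variable C : R.
Hypothesis phiC : forall n, `|phi n| <= C.
Hypothesis phi0 : weakstar_null phi.

Section biorthogonal.
Hypothesis phiJ : forall n a, phi n (J a) = a n.

Let phi_c0 x : (fun n => phi n x : R^o) \in @c0_pred R.
Proof. by apply/c0_predP; exact: phi0. Qed.

Let K x : c0 R := C0 (phi_c0 x).

Let K_bop : K \in @bop_pred R X (c0 R).
Proof.
apply: (@bop_bound _ _ _ _ C) => [a x y|x].
  by apply/val_inj/funext => n; rewrite -[LHS]/(phi n (a *: x + y)) linearP.
apply: c0_norm_le => n; apply: le_trans (opnormP _ _) _.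
by rewrite ler_wpM2r.
Qed.

Let JK_bop : (fun x => J (K x)) \in @bop_pred R X X.
Proof.
pose Kb := Bop K_bop; apply: (@bop_bound _ _ _ _ (`|J| * `|Kb|)) => [a x y|x].
  by rewrite -linearP; congr (J _); exact: (linearP Kb).
apply: le_trans (opnormP _ _) _; rewrite -mulrA ler_wpM2l//.
exact: (opnormP Kb).
Qed.

(** The projection is x |-> J (phi_n x)_n; its range is closed, as the kernel of
    the complementary projection. *)
Lemma complemented_of_biorthogonal : contains_complemented_c0 X.
Proof.
have JK : cancel J K by move=> a; apply/val_inj/funext => n; exact: phiJ.
pose P := Bop JK_bop.
exists (range J); last first.
  exists P => [|x]; last by rewrite /= JK.
  apply/seteqP; split=> [_ [x _ <-]|_ [a _ <-]]; first by exists (K x).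
  by exists (J a) => //=; rewrite JK.
split.
  have -> : range J = (fun x => x - P x) @^-1` [set 0].
    apply/seteqP; split=> [_ [a _ <-]|x] /=; first by rewrite JK subrr.
    by move=> /eqP; rewrite subr_eq0 => /eqP ->; exists (K x).
  apply: closed_comp; last exact/accessible_closed_set1/hausdorff_accessible/norm_hausdorff.
  by move=> x _; apply: cvgB; [exact: cvg_id|exact: bop_continuous].
exists J, K; split=> //; apply: (@continuous_subspaceT _ _ (range J) K) => x.
exact: (@bop_continuous _ _ _ (Bop K_bop) x).
Qed.

End biorthogonal.

(** A limit of the bounded sequence J (1,...,1,0,...) in the bidual is at least d
    at every phi n. *)
Lemma not_weakly_null_on_c0 (d : R) : 0 < d ->
  (forall n N, (n < N)%N -> d <= phi n (J (c0_trunc N (fun=> 1)))) ->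
  ~ weakly_null phi.
Proof.
move=> d0 phid wn.
have [|psi _ psiP] := @dual_limit _ _ (fun N => bidual_eval (J (c0_trunc N (fun=> 1)))) `|J|.
  move=> N; apply: le_trans (norm_bidual_eval _) _; apply: le_trans (opnormP _ _) _.
  rewrite -[leRHS]mulr1 ler_wpM2l//; apply: c0_norm_le => n /=.
  by case: ifP; rewrite ?normr1 ?normr0.
have psid n : d <= psi (phi n).
  by apply: psiP; exists n.+1 => // N /= nN; exact: phid.
have /cvgrPdist_lt/(_ _ d0)/filter_ex[n /=] := wn psi.
rewrite sub0r normrN; apply/negP; rewrite -leNgt.
by apply: le_trans (psid n) (ler_norm _).
Qed.

End complemented_copy.

Section wittstock_functionals.
Variables (R : realType) (E F : banachLatticeType R).
Variables (e : nat -> E) (M : R).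
Hypothesis e0 : forall n, 0 <=v e n.
Variables (m : nat -> nat) (g : nat -> nat -> dual F) (y : nat -> nat -> F).
Hypothesis gy : forall n, spread_family (n.+1%:R^-1) (m n) (g n) (y n).
Variable J : bop (c0 R) (wittstock E F).
Hypothesis Jlim : forall (a : c0 R) x, coef_series e (block m y a) x @ \oo --> J a x.

Lemma block_functional_biorthogonal (h : nat -> dual E) D (hD : forall n, `|h n| <= D) :
  (forall n k, h n (e k) = (k == n)%:R) ->
  forall n (a : c0 R), block_functional hD gy n (J a) = a n.
Proof.
move=> he n a; have Jh k : J a (h k) = block m y a k.
  apply: (norm_cvg_unique (@Jlim a (h k))); apply: cvg_near_cst.
  exists k.+1 => // N /= kN; rewrite /coef_series /series /= big_mkord.
  rewrite (bigD1 (Ordinal kN))//= he eqxx scale1r big1 ?addr0// => i ik.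
  by rewrite he (_ : (i : nat) == k = false) ?scale0r//; apply: negbTE.
have [_ gy1 _ _] := gy n.
rewrite -[LHS]/(block_fun h m g n (J a)) /block_fun.
under eq_bigr => j _ do rewrite Jh block_pickle// linearZ.
by rewrite -scaler_sumr gy1 -[LHS]/(_ * _) mulr1.
Qed.

(** All terms of the series that defines J a at f_k are positive, so the series is
    bounded below by its diagonal term f_k (e_k) z_k. *)
Lemma block_functional_trunc_ge (f : nat -> dual E) D (fD : forall n, `|f n| <= D) (d : R) :
  (forall n, positive (f n)) -> (forall n, d <= f n (e n)) ->
  (forall n j, positive (g n j)) -> (forall n j, 0 <=v y n j) ->
  forall n N, (n < N)%N -> d <= block_functional fD gy n (J (c0_trunc N (fun=> 1))).
Proof.
move=> pf fe pg y0 n N nN; pose a := c0_trunc (R := R) N (fun=> 1).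
have a0 k : 0 <= a k by rewrite /a /=; case: ifP.
have b0 k : 0 <=v block m y a k.
  rewrite /block; case: pickle_inv => [[i j]|]; last exact: lev_refl.
  by case: ifP => _; [apply: scalev_ge0|exact: lev_refl].
have ge k : d *: block m y a k <=v J a (f k).
  apply: (@lev_trans _ _ (f k (e k) *: block m y a k)).
    apply: (lev_subr _ _).2; rewrite -scalerBl.
    by apply: scalev_ge0 => //; rewrite subr_ge0.
  apply: (lev_subr _ _).2.
  have : (fun N => coef_series e (block m y a) (f k) N - f k (e k) *: block m y a k)
      @ \oo --> J a (f k) - f k (e k) *: block m y a k.
    by apply: cvgB; [exact: Jlim|exact: cvg_cst].
  apply: cvg_lev_ge0; exists k.+1 => // K /= kK; rewrite /coef_series /series /= big_mkord.
  rewrite (bigD1 (Ordinal kK))//= [X in _ <=v X]addrC addKr; apply: sumv_ge0 => i _.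
  by apply: scalev_ge0 => //; exact: positive_ge0.
have [_ gy1 _ _] := gy n.
rewrite -[leRHS]/(block_fun f m g n (J a)) /block_fun -[leLHS]mulr1 -gy1 mulr_sumr.
apply: ler_sum => j _; have := positive_mono (pg n j) (ge (pickle (n, j : nat))).
by rewrite block_pickle// /a /= nN scale1r linearZ.
Qed.

End wittstock_functionals.

Theorem theorem1 (R : realType) (E F : banachLatticeType R)
  (infE : infinite_dimensional E) (infF : infinite_dimensional F)
  (c0E : contains_c0 E) (bpap : BPAP (dual E) \/ BPAP (dual F)) :
  contains_complemented_c0 (wittstock E F) /\
  ~ grothendieck (wittstock E F) /\
  (reflexive_space F -> ~ positive_grothendieck (wittstock E F)).
Proof.
have [e [f [delta [M [delta0 e0 eM ef]]]]] := contains_c0_positive c0E.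
have eps0 n : 0 < n.+1%:R^-1 :> R by rewrite invr_gt0.
have [m [g [y gy]]] : exists (m : nat -> nat) (g : nat -> nat -> dual F)
    (y : nat -> nat -> F), forall n, spread_family (n.+1%:R^-1) (m n) (g n) (y n).
  have [m mP] := choice (fun n => exists_spread_family infF (eps0 n)).
  have [g gP] := choice mP; have [y yP] := choice gP.
  by exists m, g, y.
have [h [hD he]] := biorthogonal_functionals delta0 e0 ef.
have y1 n j : `|y n j| <= 1 by have [] := gy n.
have [J Jlim] := c0_embedding e0 eM m y1.
pose phi := block_functional hD gy.
have phi0 : weakstar_null phi := block_functional_weakstar_null hD gy.
have phiJ n (a : c0 R) : phi n (J a) = a n := block_functional_biorthogonal gy Jlim hD he n a.
split; [|split].
- apply: (complemented_of_biorthogonal _ phi0 phiJ (C := 2 * delta^-1)) => n.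
  exact: block_functional_norm_le.
- move=> G; apply: (@not_weakly_null_on_c0 _ _ J phi 1 ltr01) (G _ phi0) => n N nN.
  by rewrite phiJ /= nN.
move=> reflF PG.
have [m' [g' [y' gy']]] : exists (m : nat -> nat) (g : nat -> nat -> dual F)
    (y : nat -> nat -> F), forall n,
    [/\ spread_family (n.+1%:R^-1) (m n) (g n) (y n), forall j, positive (g n j) &
     forall j, 0 <=v y n j].
  have [m' mP] := choice (fun n => exists_positive_spread_family infF reflF (eps0 n)).
  have [g' gP] := choice mP; have [y' yP] := choice gP.
  by exists m', g', y'.
(* Biorthogonality would cost positivity, so the functionals f are used as they
   are; only their diagonal values matter. *)
have [gyP pg y0] := all_and3 gy'.
have y'1 n j : `|y' n j| <= 1 by have [] := gyP n.
have [J' J'lim] := c0_embedding e0 eM m' y'1.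
have f1 n : `|f n| <= 1 by have [] := ef n.
have pf n : positive (f n) by have [] := ef n.
have fe n : 3 * delta <= f n (e n) by have [] := ef n.
apply: (@not_weakly_null_on_c0 _ _ J' (block_functional f1 gyP) (3 * delta)).
- by rewrite mulr_gt0.
- exact: block_functional_trunc_ge.
apply: PG; last exact: block_functional_weakstar_null.
move=> n T T0; apply: sumr_ge0 => j _.
apply: positive_ge0 => //.
have /bop_ge0P := T0; apply; exact/bop_ge0P.
Qed.
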